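(* Let $L$ be a countable first-order language and let $\mathbf{K}$ be a Borel class of $L$-structures with domain $\omega$ such that $|\mathrm{Aut}(A)|\leq\aleph_0$ for every $A\in\mathbf{K}$. Then the isomorphism relation $\{(A,B)\in\mathbf{K}\times\mathbf{K} : A\cong B\}$ is a Borel subset of $\mathbf{K}\times\mathbf{K}$, and so in particular $\mathbf{K}$ is not Borel complete.
   Context: A Borel class of $L$-structures with domain $\omega$ is a Borel subset of the standard Borel space of all $L$-structures with domain $\omega$. Let $\mathbf{K}^{\aleph_0}_{\mathrm{gf}}$ be the standard Borel space of graphs with domain $\omega$. A Borel class $\mathbf{K}$ of $L$-structures with domain $\omega$ is Borel complete if there exists a Borel map $f:\mathbf{K}^{\aleph_0}_{\mathrm{gf}}\to\mathbf{K}$ such that for all $A,B\in\mathbf{K}^{\aleph_0}_{\mathrm{gf}}$ we have $A\cong B$ if and only if $f(A)\cong f(B)$. *)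

(* Defs.v *)
From HB Require Import structures.
From mathcomp Require Import all_boot all_order all_algebra.
From mathcomp Require Import boolp classical_sets functions cardinality measure.

Set Implicit Arguments.
Unset Strict Implicit.
Unset Printing Implicit Defensive.

Local Open Scope classical_set_scope.

(* First-order languages with equality; constants are 0-ary function symbols. *)
Record language := Language {
  fsym : Type;
  rsym : Type;
  farity : fsym -> nat;
  rarity : rsym -> nat }.

(* [countable] includes the finite case. *)
Definition countable_language (L : language) : Prop :=
  countable [set: fsym L] /\ countable [set: rsym L].

(* L-structures with domain omega. *)
Record structure (L : language) := Structure {
  fint : forall f : fsym L, (farity f).-tuple nat -> nat;
  rint : forall r : rsym L, (rarity r).-tuple nat -> bool }.

Arguments fint {L} _ _ _.
Arguments rint {L} _ _ _.

HB.instance Definition _ (L : language) := gen_eqMixin (structure L).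
HB.instance Definition _ (L : language) := gen_choiceMixin (structure L).
HB.instance Definition _ (L : language) :=
  isPointed.Build (structure L)
    (Structure (fun f (_ : (farity f).-tuple nat) => 0)
               (fun r (_ : (rarity r).-tuple nat) => false)).

(* The sets { A | f^A(a) = b } and { A | A |= r(a) }.  Together with the
   complements of the latter they are the usual subbase of the product topology
   on the space of L-structures with domain omega.  For countable L this
   topology has a countable base, made of finite intersections of these sets,
   so the sigma-algebra generated below is its Borel sigma-algebra. *)
Definition atomic_sets (L : language) : set (set (structure L)) :=
  [set X | (exists f a b, X = [set A | fint A f a = b]) \/
           (exists r a, X = [set A | rint A r a])].

HB.instance Definition _ (L : language) :=
  @isMeasurable.Build (sigma_display (@atomic_sets L)) (structure L)
    <<s @atomic_sets L >> (@sigma_algebra0 _ setT (@atomic_sets L))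
    (@sigma_algebraC _ (@atomic_sets L))
    (@sigma_algebra_bigcup _ setT (@atomic_sets L)).

Definition isomorphism (L : language) (A B : structure L) (g : nat -> nat) :
    Prop :=
  [/\ bijective g,
      forall f a, g (fint A f a) = fint B f (map_tuple g a) &
      forall r a, rint A r a = rint B r (map_tuple g a)].

Definition isomorphic (L : language) (A B : structure L) : Prop :=
  exists g, isomorphism A B g.

Definition Aut (L : language) (A : structure L) : set (nat -> nat) :=
  [set g | isomorphism A A g].

Definition graph_language : language :=
  @Language void unit (fun _ => 0) (fun _ => 2).

Definition edge (A : structure graph_language) (x y : nat) : bool :=
  rint A (tt : rsym graph_language) [tuple x; y].

(* Simple undirected graphs with domain omega. *)
Definition graphs : set (structure graph_language) :=
  [set A | irreflexive (edge A) /\ symmetric (edge A)].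

(* [measurable_fun D f] is vacuous for a non-measurable domain D; the next lemma
   rules this out for [borel_complete]. *)
Lemma measurable_graphs : measurable graphs.
Proof.
have medge x y : measurable [set A | edge A x y].
  by apply: sub_sigma_algebra; right; exists tt, [tuple x; y].
have -> : graphs = \bigcap_x ((~` [set A | edge A x x]) `&`
    \bigcap_y ((~` [set A | edge A x y]) `|` [set A | edge A y x])).
  rewrite eqEsubset; split => A /=.
    move=> [irr sym] x _; split => /=; first by rewrite irr.
    move=> y _ /=; rewrite (sym x y).
    by case: (edge A y x); [right | left].
  move=> H; split=> [x|x y].
    by have [/negP/negbTE] := H x I.
  have [_ /(_ y I) Hxy] := H x I; have [_ /(_ x I) Hyx] := H y I.
  by apply/idP/idP => E; [case: Hxy => // /(_ E) | case: Hyx => // /(_ E)].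
apply: bigcapT_measurable => x; apply: measurableI.
  exact: measurableC.
apply: bigcapT_measurable => y; apply: measurableU => //.
exact: measurableC.
Qed.

(* A Borel map from [graphs] to [K], as a total function restricted to [graphs]
   (its values elsewhere are irrelevant). *)
Definition borel_complete (L : language) (K : set (structure L)) : Prop :=
  exists f : structure graph_language -> structure L,
    [/\ measurable_fun graphs f,
        f @` graphs `<=` K &
        forall A B, graphs A -> graphs B ->
          (isomorphic A B <-> isomorphic (f A) (f B))].

(* Main.v *)
Require Import Defs.
From mathcomp Require Import all_boot all_order all_algebra.
From mathcomp Require Import boolp classical_sets functions cardinality measure.

(* A countable automorphism group has a finite tuple with trivial pointwise
   stabilizer.  The sets of A in K whose first n points have a nontrivial
   stabilizer are analytic with empty intersection, so by Novikov's separation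
   theorem K is covered by Borel sets C_n on which the first n points are a
   base.  For A in C_n an isomorphism A -> B is determined by its values s on
   0, ..., n-1, so for each c the analytic sets { (A, B) | some isomorphism
   extending s maps c to d } are pairwise disjoint in d; separating them by
   Borel sets gives a Borel map (A, B) |-> g_(A,B) which is the isomorphism
   extending s whenever there is one.  Hence isomorphism is the countable union
   over n and s of the Borel conditions "g_(A,B) is an isomorphism".

   If K were Borel complete, isomorphism of graphs would then be Borel.  But for
   every Borel set B there are graphs T1, T0 that are not isomorphic and a
   family S_x, each edge of which depends on one bit of x, with S_x isomorphic
   to T1 or T0 according to whether x is in B; this is proved by induction on B,
   coding hereditarily countable sets by graphs.  Diagonalizing over such
   families contradicts the Borelness of isomorphism. *)

Set Implicit Arguments.
Unset Strict Implicit.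
Unset Printing Implicit Defensive.

Local Open Scope classical_set_scope.

(** * Analytic sets *)

Definition baire : Type := nat -> nat.

Definition agree (n : nat) (y z : baire) : Prop :=
  forall i, i < n -> y i = z i.

Definition locally_constant (T : Type) (F : baire -> T) : Prop :=
  forall y, exists n, forall z, agree n y z -> F z = F y.

Definition closed_set (C : set baire) : Prop :=
  forall y, (forall n, exists2 z, agree n y z & C z) -> C y.

Definition column (k : nat) (y : baire) : baire := fun i => y (pickle (k, i)).

Definition interleave (ys : nat -> baire) : baire :=
  fun n => if unpickle n is Some (k, i) then ys k i else 0.

Lemma column_interleave ys k : column k (interleave ys) = ys k.
Proof. by apply/funext => i; rewrite /column /interleave pickleK. Qed.

Lemma agree_le m n y z : m <= n -> agree n y z -> agree m y z.
Proof. by move=> mn yz i im; apply: yz; apply: leq_trans mn. Qed.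

Lemma agree_reindex (s : nat -> nat) n :
  exists m, forall y z, agree m y z -> agree n (y \o s) (z \o s).
Proof.
exists (\max_(i < n) (s i).+1) => y z yz i ilt /=; apply: yz.
exact: (leq_trans _ (leq_bigmax (Ordinal ilt))).
Qed.

Lemma locally_constant_cst (T : Type) (t : T) : locally_constant (fun=> t).
Proof. by move=> y; exists 0. Qed.

(** This covers a query chosen by an earlier answer: near [y] that answer is fixed, so a single
    [H v] matters. *)
Lemma locally_constant_bind (T U : Type) (F : baire -> T) (H : T -> baire -> U) :
  locally_constant F -> (forall v, locally_constant (H v)) ->
  locally_constant (fun y => H (F y) y).
Proof.
move=> lF lH y; have [n1 h1] := lF y; have [n2 h2] := lH (F y) y.
exists (maxn n1 n2) => z yz; rewrite h1; last exact: agree_le (leq_maxl _ _) yz.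
by rewrite h2 //; apply: agree_le (leq_maxr _ _) yz.
Qed.

Lemma locally_constant_reindex (T : Type) (F : baire -> T) (s : nat -> nat) :
  locally_constant F -> locally_constant (fun y => F (y \o s)).
Proof.
move=> lF y; have [n h] := lF (y \o s); have [m hm] := agree_reindex s n.
by exists m => z yz; apply: h; apply: hm.
Qed.

Lemma locally_constant_eval n : locally_constant (fun y => y n).
Proof. by move=> y; exists n.+1 => z ->. Qed.

Lemma locally_constant_closed (F : baire -> Prop) :
  locally_constant F -> closed_set F.
Proof. by move=> lF y hy; have [n h] := lF y; have [z /h <-] := hy n. Qed.

Lemma closed_setI (C D : set baire) :
  closed_set C -> closed_set D -> closed_set (C `&` D).
Proof.
move=> cC cD y hy; split; [apply: cC => n | apply: cD => n];
  by have [z yz []] := hy n; exists z.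
Qed.

Lemma closed_set_forall (I : Type) (C : I -> set baire) :
  (forall i, closed_set (C i)) -> closed_set [set y | forall i, C i y].
Proof. by move=> cC y hy i; apply: cC => n; have [z yz /(_ i)] := hy n; exists z. Qed.

Lemma closed_set_reindex (C : set baire) (s : nat -> nat) :
  closed_set C -> closed_set [set y : baire | C (y \o s)].
Proof.
move=> cC y hy; apply: cC => n; have [m hm] := agree_reindex s n.
by have [z /hm yz Cz] := hy m; exists (z \o s).
Qed.

(* The members of [G] play the role of a clopen subbasis. *)
Definition continuous_for (X : Type) (G : set (set X)) (phi : baire -> X) : Prop :=
  forall U, G U -> locally_constant (fun y => U (phi y)).

Definition separating (X : Type) (G : set (set X)) : Prop :=
  forall x x', (forall U, G U -> U x = U x') -> x = x'.

Definition analytic (X : Type) (G : set (set X)) (P : set X) : Prop :=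
  exists phi C, [/\ continuous_for G phi, closed_set C & P = phi @` C].

Lemma continuous_for_reindex (X : Type) (G : set (set X)) phi (s : nat -> nat) :
  continuous_for G phi -> continuous_for G (fun y => phi (y \o s)).
Proof. by move=> cphi U GU; apply: (locally_constant_reindex s (cphi U GU)). Qed.

Lemma closed_set_eq (X : Type) (G : set (set X)) phi psi :
  separating G -> continuous_for G phi -> continuous_for G psi ->
  closed_set [set y | phi y = psi y].
Proof.
move=> sG cphi cpsi y hy; apply: sG => U GU.
have [n1 h1] := cphi U GU y; have [n2 h2] := cpsi U GU y.
have [z yz /= zE] := hy (maxn n1 n2).
rewrite -(h1 z); last exact: agree_le (leq_maxl _ _) yz.
by rewrite -(h2 z) ?zE //; apply: agree_le (leq_maxr _ _) yz.
Qed.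

Lemma analytic0 (X : Type) (G : set (set X)) (x : X) : analytic G set0.
Proof.
exists (fun=> x), set0; split; first by move=> U _; apply: locally_constant_cst.
  by move=> y /(_ 0)[].
by rewrite image_set0.
Qed.

(** The coordinate [y 0] chooses the set [P k], and the rest of [y] is a parameter for it. *)
Lemma analytic_bigcup (X : Type) (G : set (set X)) (P : nat -> set X) :
  (forall k, analytic G (P k)) -> analytic G (\bigcup_k P k).
Proof.
move=> aP; have [phi hphi] := choice aP; have [C hC] := choice hphi.
exists (fun y => phi (y 0) (y \o succn)), [set y : baire | C (y 0) (y \o succn)]; split.
- move=> U GU.
  apply: (locally_constant_bind (H := fun k y => U (phi k (y \o succn)))).
    exact: locally_constant_eval.
  by move=> k; have [cphi _ _] := hC k; apply: (continuous_for_reindex succn cphi).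
- move=> y hy /=; have [_ cC _] := hC (y 0).
  apply: (closed_set_reindex (s := succn) cC) => n.
  have [z yz Cz] := hy n.+1; exists z; first exact: agree_le yz.
  by rewrite /= (yz 0).
- rewrite eqEsubset; split => [x [k _]|_ [y Cy <-]].
    have [_ _ ->] := hC k => -[y Cy <-].
    by exists (fun i => if i is j.+1 then y j else k).
  by exists (y 0) => //; have [_ _ ->] := hC (y 0); exists (y \o succn).
Qed.

(** Column [k] is a parameter for [P k]; that all columns have the same image is a closed condition
    because [G] separates points. *)
Lemma analytic_bigcap (X : Type) (G : set (set X)) (P : nat -> set X) :
  separating G -> (forall k, analytic G (P k)) -> analytic G (\bigcap_k P k).
Proof.
move=> sG aP; have [phi hphi] := choice aP; have [C hC] := choice hphi.
have cphi k : continuous_for G (fun y => phi k (column k y)).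
  have [h _ _] := hC k.
  exact: (continuous_for_reindex (fun i => pickle (k, i)) h).
exists (fun y => phi 0 (column 0 y)),
  [set y | forall k, C k (column k y) /\ phi k (column k y) = phi 0 (column 0 y)].
split; first exact: cphi.
- apply: closed_set_forall => k; apply: closed_setI.
    have [_ h _] := hC k.
    exact: (closed_set_reindex (s := fun i => pickle (k, i)) h).
  exact: closed_set_eq sG (cphi k) (cphi 0).
- rewrite eqEsubset; split => [x Px|_ [y Cy <-] k _].
    have /choice[ys hys] : forall k, exists y, C k y /\ phi k y = x.
      by move=> k; have := Px k I; have [_ _ ->] := hC k => -[y ? ?]; exists y.
    exists (interleave ys) => /=; last by rewrite column_interleave; case: (hys 0).
    by move=> k; rewrite !column_interleave (hys 0).2; exact: hys.
  by have [Ck <-] := Cy k; have [_ _ ->] := hC k; exists (column k y).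
Qed.

(** The sets that are analytic together with their complements form a sigma-algebra; it contains
    [G], whose members pull back to clopen sets under the surjection [e]. *)
Lemma borel_analytic (X : Type) (G : set (set X)) (e : baire -> X) :
  separating G -> continuous_for G e -> (forall x, exists y, e y = x) ->
  <<s G >> `<=` analytic G.
Proof.
move=> sG ce se.
have aclopen (U : set X) : locally_constant (fun y => U (e y)) -> analytic G U.
  move=> lU; exists e, [set y | U (e y)]; split => //.
    exact: locally_constant_closed lU.
  rewrite eqEsubset; split => [x Ux|_ [y Uy <-] //].
  by have [y yx] := se x; exists y => //=; rewrite yx.
have aT (t : Prop) : analytic G [set _ | t].
  by apply: aclopen; apply: locally_constant_cst.
suff : <<s G >> `<=` [set P | analytic G P /\ analytic G (~` P)].
  by move=> h P /h[].
apply: smallest_sub; last first.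
  move=> U GU; split; apply: aclopen; first exact: ce.
  exact: (locally_constant_bind (H := fun p _ => ~ p) (ce U GU))
    (fun p => locally_constant_cst _).
split.
- split; first exact: (aT False).
  by rewrite setC0; exact: (aT True).
- by move=> P [aP aPc]; rewrite setTD; split; rewrite ?setCK.
- move=> F aF; split; first by apply: analytic_bigcup => k; case: (aF k).
  by rewrite setC_bigcup; apply: analytic_bigcap => // k; case: (aF k).
Qed.

Lemma analytic_proj (X : Type) (G : set (set X)) (P : set X)
    (Q : X -> baire -> Prop) :
  analytic G P ->
  (forall phi, continuous_for G phi -> closed_set [set y | Q (phi y) (column 1 y)]) ->
  analytic G [set x | P x /\ exists z, Q x z].
Proof.
move=> [phi [C [cphi cC ->]]] cQ.
have cphi0 := continuous_for_reindex (fun i => pickle (0, i)) cphi.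
exists (fun y => phi (column 0 y)),
  ([set y | C (column 0 y)] `&` [set y | Q (phi (column 0 y)) (column 1 y)]).
split => //.
  apply: closed_setI; last exact: cQ cphi0.
  exact: (closed_set_reindex (s := fun i => pickle (0, i)) cC).
rewrite eqEsubset; split => [_ [[y Cy <-] [z Qz]]|_ [y [Cy Qy] <-]].
  exists (interleave (fun k => if k is 0 then y else z)); last by rewrite column_interleave.
  by split; rewrite /= ?column_interleave.
by split; [exists (column 0 y) | exists (column 1 y)].
Qed.

Definition product_subbasis (X Y : Type) (G : set (set X)) (H : set (set Y)) :
    set (set (X * Y)) :=
  [set U | (exists2 V, G V & U = fst @^-1` V) \/ (exists2 V, H V & U = snd @^-1` V)].

Lemma separating_product (X Y : Type) (G : set (set X)) (H : set (set Y)) :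
  separating G -> separating H -> separating (product_subbasis G H).
Proof.
move=> sG sH [x1 y1] [x2 y2] h; congr pair.
  by apply: sG => U GU; apply: (h (fst @^-1` U)); left; exists U.
by apply: sH => U HU; apply: (h (snd @^-1` U)); right; exists U.
Qed.

Lemma analytic_product (X Y : Type) (G : set (set X)) (H : set (set Y)) P Q :
  analytic G P -> analytic H Q -> analytic (product_subbasis G H) (P `*` Q).
Proof.
move=> [phi [C [cphi cC ->]]] [psi [D [cpsi cD ->]]].
exists (fun y => (phi (column 0 y), psi (column 1 y))),
  ([set y | C (column 0 y)] `&` [set y | D (column 1 y)]); split.
- move=> U [[V GV ->]|[V HV ->]].
    exact: (continuous_for_reindex (fun i => pickle (0, i)) cphi) GV.
  exact: (continuous_for_reindex (fun i => pickle (1, i)) cpsi) HV.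
- apply: closed_setI.
    exact: (closed_set_reindex (s := fun i => pickle (0, i)) cC).
  exact: (closed_set_reindex (s := fun i => pickle (1, i)) cD).
- rewrite eqEsubset; split => [[_ _] [/= [y Cy <-] [z Dz <-]]|_ [y [Cy Dy] <-]].
    exists (interleave (fun k => if k is 0 then y else z)); last by rewrite !column_interleave.
    by split; rewrite /= column_interleave.
  by split; [exists (column 0 y) | exists (column 1 y)].
Qed.

(** * Separation theorems *)

(* A point [y] codes one branch [column k y] for each [k]; the recursion fixes the values of [y] one at a time while keeping
   the pieces below the finite initial segment inseparable.  Fixing [y n]
   refines the piece of a single [k] only, and countable unions in one
   coordinate preserve separability. *)
Lemma novikov_separation (d : measure_display) (X : measurableType d)
    (G : set (set X)) (P : nat -> set X) :
  G `<=` measurable -> separating G -> (forall k, analytic G (P k)) ->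
  \bigcap_k P k = set0 ->
  exists B : nat -> set X,
    [/\ forall k, measurable (B k), forall k, P k `<=` B k & \bigcap_k B k = set0].
Proof.
move=> mG sG aP P0; have [phi hphi] := choice aP; have [C hC] := choice hphi.
pose piece (n : nat) (y : baire) k := [set x | exists z,
  [/\ agree n y z, C k (column k z) & phi k (column k z) = x]].
pose separable n y := exists B : nat -> set X,
  [/\ forall k, measurable (B k), forall k, piece n y k `<=` B k &
      \bigcap_k B k = set0].
pose upd (y : baire) (n j : nat) : baire := fun i => if i == n then j else y i.
have refine n y : (forall j, separable n.+1 (upd y n j)) -> separable n y.
  move=> /choice[B hB].
  pose k0 : nat := if (unpickle n : option (nat * nat)) is Some (k, i) then k else 0.
  (* At most column [k0] reads coordinate [n]: its piece is a union over the values [j], while any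
     other piece lies in every [B j k]. *)
  exists (fun k => if k == k0 then \bigcup_j B j k else \bigcap_j B j k); split.
  - move=> k; case: ifP => _.
      by apply: bigcupT_measurable => j; case: (hB j).
    by apply: bigcapT_measurable => j; case: (hB j).
  - move=> k x [z [yz Cz <-]]; case: ifPn => [_|kk0].
      exists (z n) => //; have [_ h _] := hB (z n); apply: h; exists z; split => //.
      move=> i; rewrite ltnS leq_eqVlt /upd => /orP[/eqP->|ilt]; first by rewrite eqxx.
      by rewrite (ltn_eqF ilt) yz.
    move=> j _; have [_ h _] := hB j; apply: h.
    have E : column k (upd z n j) = column k z.
      apply/funext => i; rewrite /column /upd; case: eqP => // ni.
      by move: kk0; rewrite /k0 -ni pickleK eqxx.
    exists (upd z n j); rewrite E; split => // i; rewrite ltnS leq_eqVlt /upd.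
    by move=> /orP[/eqP->|ilt]; [rewrite eqxx | rewrite (ltn_eqF ilt) yz].
  - rewrite -subset0 => x Bx.
    have := Bx k0 I; rewrite eqxx => -[j _ Bj].
    have [_ _ h] := hB j; rewrite -h => k _.
    by have := Bx k I; case: eqP => [-> _ //|_]; apply.
have [|nsep] := pselect (separable 0 (fun=> 0)).
  move=> [B [mB PB B0]]; exists B; split => // k x Px; apply: PB.
  move: Px; have [_ _ ->] := hC k => -[y Cy <-].
  by exists (interleave (fun=> y)); rewrite column_interleave.
have step n y : exists j, ~ separable n y -> ~ separable n.+1 (upd y n j).
  have [[j hj]|h] := pselect (exists j, ~ separable n.+1 (upd y n j)); first by exists j.
  exists 0 => ns; case: ns; apply: refine => j.
  by apply: contrapT => ns; apply: h; exists j.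
have /choice[jj hj] : forall ny : nat * baire, exists j,
    ~ separable ny.1 ny.2 -> ~ separable ny.1.+1 (upd ny.2 ny.1 j).
  by move=> ny; apply: step.
pose Y := fix Y n : baire := if n is n'.+1 then upd (Y n') n' (jj (n', Y n')) else fun=> 0.
have nsY n : ~ separable n (Y n) by elim: n => // n /(hj (n, Y n)).
pose y : baire := fun n => Y n.+1 n.
have agY n : agree n (Y n) y.
  elim: n => // n IH i; rewrite ltnS leq_eqVlt => /orP[/eqP-> //|ilt].
  by rewrite -IH // /= /upd (ltn_eqF ilt).
have nsy n : ~ separable n y.
  move=> [B [mB PB B0]]; apply: (nsY n); exists B; split => // k x [z [yz Cz zx]].
  by apply: PB; exists z; split => // i ilt; rewrite -yz // agY.
(* Otherwise, [C k] being closed, some initial segment of [y] has an empty [k]-th piece, and the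
   empty set there with full sets elsewhere separates. *)
have Cy k : C k (column k y).
  have [_ cC _] := hC k.
  have cC' := closed_set_reindex (s := fun i => pickle (k, i)) cC.
  apply: cC' => n; apply: contrapT => none; apply: (nsy n).
  exists (fun k' => if k' == k then set0 else setT); split.
  - by move=> k'; case: ifP.
  - move=> k' x [z [yz Cz _]]; case: eqP => // E; apply: none; exists z => //.
    by move: Cz; rewrite E.
  - by rewrite -subset0 => x /(_ k I); rewrite eqxx.
pose x k := phi k (column k y).
have [k xk] : exists k, x k <> x 0.
  apply: contrapT => /forallNP h; suff : set0 (x 0) by [].
  rewrite -P0 => k _; have /contrapT <- := h k.
  by have [_ _ ->] := hC k; exists (column k y).
have [U GU Uxk] : exists2 U, G U & U (x k) <> U (x 0).
  apply: contrapT => h; apply: xk; apply: sG => U GU.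
  by apply: contrapT => UU; apply: h; exists U.
have lU k' : locally_constant (fun z => U (phi k' (column k' z))).
  have [c _ _] := hC k'.
  exact: (continuous_for_reindex (fun i => pickle (k', i)) c).
have [n1 h1] := lU 0 y; have [n2 h2] := lU k y.
exfalso; apply: (nsy (maxn n1 n2)).
have mU : measurable U by apply: mG.
have mS (p : Prop) : measurable [set z | U z = p].
  have [pt|pf] := pselect p.
    rewrite (_ : [set z | _] = U) //; apply/seteqP.
    by split => z /=; rewrite (propT pt) ?propeqE; tauto.
  rewrite (_ : [set z | _] = ~` U); first exact: measurableC.
  by apply/seteqP; split => z /=; rewrite (propF pf) propeqE; tauto.
(* Near [y], the pieces 0 and [k] lie on opposite sides of [U], so [U] and its complement separate
   them. *)
exists (fun k' => if k' == 0 then [set z | U z = U (x 0)] else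
          if k' == k then [set z | U z = U (x k)] else setT); split.
- by move=> k'; case: ifP => // _; case: ifP.
- move=> k' _ [z [yz _ <-]]; case: eqP => [->|_] /=.
    by apply: h1; apply: agree_le yz; apply: leq_maxl.
  case: eqP => [->|_] //=.
  by apply: h2; apply: agree_le yz; apply: leq_maxr.
- rewrite -subset0 => z hz; apply: Uxk.
  have k0 : k != 0 by apply/eqP => k0; apply: xk; rewrite k0.
  have := hz 0 I; have := hz k I; rewrite /= (negbTE k0) eqxx /= => <-; exact.
Qed.

(** Novikov separation for [P], [Q], [Q], ...: a point of [Q] in [B 0] would lie in every [B k]. *)
Lemma lusin_separation (d : measure_display) (X : measurableType d)
    (G : set (set X)) (P Q : set X) :
  G `<=` measurable -> separating G -> analytic G P -> analytic G Q ->
  P `&` Q = set0 ->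
  exists B, [/\ measurable B, P `<=` B & B `&` Q = set0].
Proof.
move=> mG sG aP aQ PQ0.
have [||B [mB hB B0]] := novikov_separation
    (P := fun k => if k == 0 then P else Q) mG sG.
- by move=> k; case: ifP.
- by rewrite -subset0 => x hx; rewrite -PQ0; split; [exact: (hx 0) | exact: (hx 1)].
exists (B 0); split; [exact: mB | exact: (hB 0) |].
rewrite -subset0 => x [Bx Qx]; rewrite -B0 => -[//|k] _.
exact: (hB k.+1).
Qed.

(** For countable [T] this is measurability into the discrete space [T]. *)
Definition fibres_measurable (d : measure_display) (X : measurableType d)
    (T : Type) (F : X -> T) : Prop :=
  forall v, measurable [set x | F x = v].

(** Each [Q k] is separated from the union of the others; the separating sets, made disjoint, are
    the fibres of [gamma] up to a default value. *)
Lemma borel_selector (d : measure_display) (X : measurableType d)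
    (G : set (set X)) (Q : nat -> set X) :
  G `<=` measurable -> separating G -> (forall k, analytic G (Q k)) ->
  (forall k l x, Q k x -> Q l x -> k = l) ->
  exists gamma : X -> nat,
    fibres_measurable gamma /\ forall k x, Q k x -> gamma x = k.
Proof.
move=> mG sG aQ dQ.
have /choice[E hE] : forall k, exists E,
    [/\ measurable E, Q k `<=` E & E `&` \bigcup_(l in [set l | l != k]) Q l = set0].
  move=> k.
  have aQk : analytic G (\bigcup_(l in [set l | l != k]) Q l).
    have -> : \bigcup_(l in [set l | l != k]) Q l =
        \bigcup_l (if l == k then set0 else Q l).
      apply/seteqP; split => [x [l /= lk Qx]|x [l _]].
        by exists l => //; rewrite (negbTE lk).
      by case: ifPn => // lk Qx; exists l.
    by apply: analytic_bigcup => l; case: ifP => // _; apply: analytic0 point.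
  apply: lusin_separation sG _ aQk _ => //.
  by rewrite -subset0 => x [Qk [l /= /eqP lk Ql]]; apply: lk; apply: dQ Ql Qk.
pose D k := E k `\` \bigcup_(l in [set l | l < k]) E l.
have mD k : measurable (D k).
  apply: measurableD; first by case: (hE k).
  by apply: bigcup_measurable => l _; case: (hE l).
have dD k l x : D k x -> D l x -> k = l.
  move=> [Ek nk] [El nl]; case: (ltngtP k l) => // kl.
    by case: nl; exists k.
  by case: nk; exists l.
exists (fun x => xget 0 [set k | D k x]).
have gD k x : D k x -> xget 0 [set k | D k x] = k.
  by move=> Dk; case: xgetP => [l _ /= Dl|/(_ k)//]; apply: dD Dl Dk.
split=> [k|k x Qk]; last first.
  apply: gD; have [_ QE _] := hE k; split; first exact: QE.
  move=> [l /= lk El]; have [_ _ h] := hE l.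
  suff : set0 x by []; rewrite -h; split => //; exists k => //=.
  by rewrite gtn_eqF.
(* [0] is also the default off all [D k], so its fibre is a complement. *)
case: k => [|k].
  rewrite (_ : [set x | _] = ~` \bigcup_k D k.+1).
    by apply: measurableC; apply: bigcupT_measurable.
  apply/seteqP; split => [x /= h [k _ Dk]|x /= h].
    by move: h; rewrite (gD _ _ Dk).
  case: xgetP => // -[//|k] _ Dk; case: h; by exists k.
rewrite (_ : [set x | _] = D k.+1) //.
by apply/seteqP; split => [x /=|x /gD //]; case: xgetP => // l _ Dl <-.
Qed.

(** * Isomorphism of structures with countable automorphism groups *)

Lemma isomorphism_comp (L : language) (A B C : structure L) g h :
  isomorphism A B g -> isomorphism B C h -> isomorphism A C (h \o g).
Proof.
move=> [bg fg rg] [bh fh rh]; split; first exact: bij_comp.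
- move=> f a /=; rewrite fg fh; congr fint; apply: val_inj.
  by rewrite /= map_comp.
- move=> r a /=; rewrite rg rh; congr rint; apply: val_inj.
  by rewrite /= map_comp.
Qed.

Lemma isomorphism_inv (L : language) (A B : structure L) g h :
  isomorphism A B g -> cancel g h -> cancel h g -> isomorphism B A h.
Proof.
move=> [_ fg rg] gh hg.
have E n (a : n.-tuple nat) : map_tuple g (map_tuple h a) = a.
  by apply: val_inj; rewrite /= -map_comp -[RHS]map_id; apply: eq_map => x /=.
split; first by exists g.
- by move=> f a; rewrite -{1}(E _ a) -fg gh.
- by move=> r a; rewrite -{1}(E _ a) -rg.
Qed.

(* If every finite initial segment is fixed by a nontrivial automorphism, an
   infinite composition of such automorphisms converges to an automorphism
   that differs from each member of a given enumeration. *)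
Lemma countable_Aut_rigid (L : language) (A : structure L) :
  countable (Aut A) ->
  exists n, forall g, isomorphism A A g -> (forall i, i < n -> g i = i) ->
    forall i, g i = i.
Proof.
move=> /countable_injP[iota iota_inj]; apply: contrapT => nrigid.
have /choice[F hF] : forall n, exists ffm : (nat -> nat) * (nat -> nat) * nat,
    [/\ isomorphism A A ffm.1.1, cancel ffm.1.1 ffm.1.2, cancel ffm.1.2 ffm.1.1,
        forall i, i < n -> ffm.1.1 i = i & ffm.1.1 ffm.2 <> ffm.2].
  move=> n; apply: contrapT => none; apply: nrigid; exists n => g ig fg i.
  apply: contrapT => gi; apply: none; have [[h gh hg] _ _] := ig.
  by exists (g, h, i).
pose f n := (F n).1.1; pose f' n := (F n).1.2; pose m n := (F n).2.
pose E k := xget (id : nat -> nat) [set g | Aut A g /\ iota g = k].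
(* The new bound exceeds the old one, the moved point [m N] and the preimages of 0, ..., [k]: this
   freezes the disagreement with [E k] and makes the limit surjective. *)
pose next k (h' : nat -> nat) N := (N + m N + \max_(j < k.+1) h' j).+1.
pose step k (s : (nat -> nat) * (nat -> nat) * nat) :=
  let: (h, h', N) := s in
  if h (m N) == E k (m N) then (h \o f N, f' N \o h', next k (f' N \o h') N)
  else (h, h', next k h' N).
pose st := fix st k := if k is k'.+1 then step k' (st k') else (id, id, 0).
pose h k := (st k).1.1; pose h' k := (st k).1.2; pose N k := (st k).2.
have stE k : st k = (h k, h' k, N k) by rewrite /h /h' /N; case: (st k) => -[].
have hSE k :
    [/\ h k (m (N k)) = E k (m (N k)), h k.+1 = h k \o f (N k) &
        h' k.+1 = f' (N k) \o h' k] \/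
    [/\ h k (m (N k)) <> E k (m (N k)), h k.+1 = h k & h' k.+1 = h' k].
  case: (eqVneq (h k (m (N k))) (E k (m (N k)))) => e; [left|right];
    by split; rewrite /h /h' /= ?stE /= ?e ?eqxx ?(negbTE e) //; apply/eqP.
have inv k : [/\ isomorphism A A (h k), cancel (h k) (h' k) & cancel (h' k) (h k)].
  elim: k => [|k [ih hh' h'h]].
    split=> //; split; first by exists id.
      by move=> g a; congr fint; apply: val_inj; rewrite /= map_id.
    by move=> r a; congr rint; apply: val_inj; rewrite /= map_id.
  have [[_ -> ->]|[_ -> ->] //] := hSE k.
  have [if_ ff' f'f _ _] := hF (N k); split; first exact: isomorphism_comp if_ ih.
    exact: can_comp hh' ff'.
  exact: can_comp f'f h'h.
have NS k : N k.+1 = next k (h' k.+1) (N k).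
  by rewrite {1}/N /h' /= stE /=; case: ifP.
have hS k i : i < N k -> h k.+1 i = h k i.
  move=> ilt; have [[_ -> _]|[_ -> _] //] := hSE k.
  by have [_ _ _ fx _] := hF (N k); congr (h k _); apply: fx.
have ltN k : N k < N k.+1 by rewrite NS /next ltnS -addnA leq_addr.
have leN k : k <= N k by elim: k => // k IH; apply: leq_ltn_trans IH (ltN k).
have monoN k l : k <= l -> N k <= N l.
  by move/subnK <-; elim: (l - k) => // j IH; apply: leq_trans IH (ltnW (ltN _)).
have hle k l i : i < N k -> k <= l -> h l i = h k i.
  move=> ilt /subnK <-; elim: (l - k) => // j IH.
  by rewrite addSn hS //; apply: leq_trans ilt (monoN _ _ (leq_addl _ _)).
(* From stage [i.+1] on the value at [i] no longer changes, as [i < N i.+1]. *)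
pose g i := h i.+1 i.
have gE i k : i < N k -> g i = h k i.
  move=> ilt; rewrite /g -(@hle i.+1 (maxn i.+1 k)) ?leq_maxl //.
  by rewrite (@hle k) ?leq_maxr.
have gh j : g (h' j.+1 j) = j.
  rewrite (gE _ j.+1); first by have [_ _ ->] := inv j.+1.
  rewrite NS /next ltnS; apply: leq_trans (leq_addl _ _).
  exact: (leq_bigmax (Ordinal (ltnSn j))).
have g_inj : injective g.
  move=> i j; pose k := maxn i.+1 j.+1.
  have ik : i < N k by apply: leq_trans (leN k); apply: leq_maxl.
  have jk : j < N k by apply: leq_trans (leN k); apply: leq_maxr.
  rewrite (gE _ _ ik) (gE _ _ jk); have [_ hh' _] := inv k; exact: can_inj hh' _ _.
have gtuple n (a : n.-tuple nat) b :
    exists k, map_tuple g a = map_tuple (h k) a /\ g b = h k b.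
  pose k := (b + \max_(i <- a) i).+1; exists k; split; last first.
    by apply: gE; apply: leq_trans (leN k); rewrite ltnS leq_addr.
  apply: val_inj => /=; apply/eq_in_map => i ia; apply: gE.
  apply: leq_trans (leN k); rewrite ltnS; apply: leq_trans (leq_addl _ _).
  by apply: (leq_bigmax_seq (F := id)).
have ig : isomorphism A A g.
  split.
  - exists (fun j => h' j.+1 j); last exact: gh.
    by move=> i; apply: g_inj; rewrite gh.
  - move=> s a; have [k [-> ->]] := gtuple _ a (fint A s a).
    by have [[_ -> _] _ _] := inv k.
  - move=> r a; have [k [-> _]] := gtuple _ a 0.
    by have [[_ _ ->] _ _] := inv k.
have gEk : E (iota g) = g.
  rewrite /E; case: xgetP => [g' _ /= [Ag' ig']|/(_ g)[]//].
  by apply: iota_inj; rewrite ?inE.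
(* Stage [iota g] forced a disagreement with [g] itself. *)
pose k := iota g.
have mlt : m (N k) < N k.+1.
  by rewrite NS /next ltnS -addnA addnCA leq_addr.
have := gE _ _ mlt; have [[e -> _]|[ne -> _]] := hSE k; last first.
  by move=> ge; apply: ne; rewrite -ge gEk.
have [_ hh' _] := inv k; rewrite -gEk -e => /(can_inj hh') e'.
by have [_ _ _ _] := hF (N k); apply.
Qed.

(* Both "locally constant" and "measurable with countable range" have this
   form, so the atomic conditions on an isomorphism are treated once. *)
Definition bind_closed (Y : Type) (M : forall T : countType, (Y -> T) -> Prop) :=
  (forall (T : countType) (t : T), M T (fun=> t)) /\
  (forall (T U : countType) (F : Y -> T) (H : T -> Y -> U),
     M T F -> (forall v, M U (H v)) -> M U (fun y => H (F y) y)).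

Lemma bind_closed_tuple (Y : Type) (M : forall T : countType, (Y -> T) -> Prop)
    (g : Y -> nat -> nat) n (a : n.-tuple nat) :
  bind_closed M -> (forall i, M nat (g^~ i)) ->
  M (n.-tuple nat : countType) (fun y => map_tuple (g y) a).
Proof.
move=> [Mc Mb] Mg.
have Ms (s : seq nat) : M (seq nat) (fun y => map (g y) s).
  elim: s => [|i s IH] /=; first exact: (Mc (seq nat) [::]).
  apply: (Mb nat (seq nat) (g^~ i) (fun v y => v :: map (g y) s)) => // v.
  exact: (Mb (seq nat) (seq nat) _ (fun w y => v :: w)).
have -> : (fun y => map_tuple (g y) a) =
    (fun y => insubd (nseq_tuple n 0) (map (g y) a)).
  by apply/funext => y; apply: val_inj; rewrite val_insubd /= size_map size_tuple eqxx.
apply: (Mb (seq nat) _ (fun y => map (g y) a) (fun w y => insubd (nseq_tuple n 0) w)) => //.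
Qed.

Lemma bind_closed_fint (L : language) (Y : Type)
    (M : forall T : countType, (Y -> T) -> Prop) (A B : Y -> structure L)
    (g : Y -> nat -> nat) f a :
  bind_closed M -> (forall i, M nat (g^~ i)) ->
  (forall f a, M nat (fun y => fint (A y) f a)) ->
  (forall f a, M nat (fun y => fint (B y) f a)) ->
  M bool (fun y => g y (fint (A y) f a) == fint (B y) f (map_tuple (g y) a)).
Proof.
move=> MM Mg MA MB; have [Mc Mb] := MM.
apply: (Mb nat bool (fun y => fint (A y) f a)
  (fun v y => g y v == fint (B y) f (map_tuple (g y) a))) => // v.
apply: (Mb nat bool (g^~ v) (fun w y => w == fint (B y) f (map_tuple (g y) a))) => // w.
apply: (Mb _ bool (fun y => map_tuple (g y) a) (fun b y => w == fint (B y) f b)).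
  exact: bind_closed_tuple.
by move=> b; apply: (Mb nat bool (fun y => fint (B y) f b) (fun c y => w == c)).
Qed.

Lemma bind_closed_rint (L : language) (Y : Type)
    (M : forall T : countType, (Y -> T) -> Prop) (A B : Y -> structure L)
    (g : Y -> nat -> nat) r a :
  bind_closed M -> (forall i, M nat (g^~ i)) ->
  (forall r a, M bool (fun y => rint (A y) r a)) ->
  (forall r a, M bool (fun y => rint (B y) r a)) ->
  M bool (fun y => rint (A y) r a == rint (B y) r (map_tuple (g y) a)).
Proof.
move=> MM Mg MA MB; have [Mc Mb] := MM.
apply: (Mb bool bool (fun y => rint (A y) r a)
  (fun v y => v == rint (B y) r (map_tuple (g y) a))) => // v.
apply: (Mb _ bool (fun y => map_tuple (g y) a) (fun b y => v == rint (B y) r b)).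
  exact: bind_closed_tuple.
by move=> b; apply: (Mb bool bool (fun y => rint (B y) r b) (fun c y => v == c)).
Qed.

Lemma locally_constant_bind_closed :
  bind_closed (fun T : countType => @locally_constant T).
Proof.
by split=> [T t|T U F H]; [apply: locally_constant_cst | apply: locally_constant_bind].
Qed.

Lemma measurable_exists (d : measure_display) (X : measurableType d) (T : Type)
    (P : T -> set X) :
  countable [set: T] -> (forall t, measurable (P t)) ->
  measurable [set x | exists t, P t x].
Proof.
move=> /countable_injP[iota inj] mP.
rewrite (_ : [set x | _] = \bigcup_n [set x | exists2 t, iota t = n & P t x]).
  apply: bigcupT_measurable => n.
  have [[t tn]|none] := pselect (exists t, iota t = n).
    rewrite (_ : [set x | _] = P t) //; apply/seteqP; split => [x [t' t'n]|x]; last by exists t.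
    by have -> // : t' = t; apply: inj; rewrite ?inE // t'n.
  rewrite (_ : [set x | _] = set0) // -subset0 => x [t tn _].
  by apply: none; exists t.
by apply/seteqP; split => [x [t Px]|x [n _ [t _ Px]]]; [exists (iota t) => //; exists t | exists t].
Qed.

Lemma measurable_forall (d : measure_display) (X : measurableType d) (T : Type)
    (P : T -> set X) :
  countable [set: T] -> (forall t, measurable (P t)) ->
  measurable [set x | forall t, P t x].
Proof.
move=> cT mP; rewrite (_ : [set x | _] = ~` [set x | exists t, (~` P t) x]).
  by apply: measurableC; apply: measurable_exists => // t; apply: measurableC.
apply/seteqP; split => [x Px [t /(_ (Px t))] //|x /= h t].
by apply: contrapT => nP; apply: h; exists t.
Qed.

Lemma fibres_measurable_bind_closed (d : measure_display) (X : measurableType d) :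
  bind_closed (fun T : countType => @fibres_measurable d X T).
Proof.
split=> [T t v|T U F H mF mH u].
  by have [->|tv] := pselect (t = v);
    [rewrite (_ : [set x | _] = setT) | rewrite (_ : [set x | _] = set0)] => //;
    apply/seteqP; split.
rewrite (_ : [set x | _] = [set x | exists v, ([set x | F x = v] `&` [set x | H v x = u]) x]).
  by apply: measurable_exists => // v; apply: measurableI; [apply: mF | apply: mH].
by apply/seteqP; split => [x /= Hx|x [v [/= -> ->]] //]; exists (F x).
Qed.

(** Bijectivity is expressed as injectivity and surjectivity, so that all quantifiers range over
    countable sets. *)
Lemma measurable_isomorphism (L : language) (d : measure_display)
    (X : measurableType d) (A B : X -> structure L) (g : X -> nat -> nat) :
  countable_language L ->
  (forall i, fibres_measurable (g^~ i)) ->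
  (forall f a, fibres_measurable (fun x => fint (A x) f a)) ->
  (forall f a, fibres_measurable (fun x => fint (B x) f a)) ->
  (forall r a, fibres_measurable (fun x => rint (A x) r a)) ->
  (forall r a, fibres_measurable (fun x => rint (B x) r a)) ->
  measurable [set x | isomorphism (A x) (B x) (g x)].
Proof.
move=> [cf cr] mg mfA mfB mrA mrB.
have bc := fibres_measurable_bind_closed X.
rewrite (_ : [set x | _] =
   ([set x | forall ij, (~` ([set x | g x ij.1 = g x ij.2] `\` [set _ | ij.1 = ij.2])) x]
    `&` [set x | forall j, exists i, [set x | g x i = j] x])
   `&` ([set x | forall f, [set x | forall a,
          [set x | (g x (fint (A x) f a) == fint (B x) f (map_tuple (g x) a)) = true] x] x]
    `&` [set x | forall r, [set x | forall a,
          [set x | (rint (A x) r a == rint (B x) r (map_tuple (g x) a)) = true] x] x])); last first.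
  apply/seteqP; split => [x [[h gh hg] hf hr]|x [[inj surj] [hf hr]]].
    split; split => /=.
    - by move=> [i j] /= [/(can_inj gh)].
    - by move=> j; exists (h j); apply: hg.
    - by move=> f a; apply/eqP; apply: hf.
    - by move=> r a; apply/eqP; apply: hr.
  have inj' : injective (g x).
    by move=> i j e; apply: contrapT => ij; apply: (inj (i, j)).
  split.
  - have [h hh] := choice surj; exists h; last exact: hh.
    by move=> i; apply: inj'; rewrite hh.
  - by move=> f a; apply/eqP; apply: hf.
  - by move=> r a; apply/eqP; apply: hr.
apply: measurableI; apply: measurableI.
- apply: measurable_forall => // -[i j]; apply: measurableC; apply: measurableD.
    have [_ mb] := bc.
    have := mb nat bool (g^~ i) (fun v x => v == g x j) (mg i).
    rewrite (_ : [set x | _] = [set x | (g x i == g x j) = true]); last first.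
      by apply/seteqP; split => x /eqP.
    apply => v.
    by have := mb nat bool (g^~ j) (fun w x => v == w) (mg j); apply => w; apply: bc.1.
  have [/= ->|ij] := pselect (i = j).
    by rewrite (_ : [set x | _] = setT) //; apply/seteqP; split.
  by rewrite (_ : [set x | _] = set0) //; apply/seteqP; split.
- by apply: measurable_forall => // j; apply: measurable_exists => // i; apply: mg.
- apply: measurable_forall => // f; apply: measurable_forall => // a.
  exact: (bind_closed_fint a bc mg mfA mfB true).
- apply: measurable_forall => // r; apply: measurable_forall => // a.
  exact: (bind_closed_rint a bc mg mrA mrB true).
Qed.

(** * Structures parametrized by Baire space *)

Lemma separating_atomic (L : language) : separating (@atomic_sets L).
Proof.
move=> [fA rA] [fB rB] h.
have -> : fA = fB.
  apply: functional_extensionality_dep => f; apply/funext => a.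
  have E : (fA f a = fA f a) = (fB f a = fA f a).
    by apply: (h [set A | fint A f a = fA f a]); left; exists f, a, (fA f a).
  by apply/esym; rewrite -E.
have -> // : rA = rB.
apply: functional_extensionality_dep => r; apply/funext => a.
have E : (rA r a : Prop) = rB r a.
  by apply: (h [set A | rint A r a]); right; exists r, a.
by apply/idP/idP; rewrite E.
Qed.

Lemma atomic_measurable (L : language) :
  @atomic_sets L `<=` (measurable : set (set (structure L))).
Proof. exact: sub_sigma_algebra. Qed.

Lemma continuous_fint (L : language) (phi : baire -> structure L) f a :
  continuous_for (@atomic_sets L) phi -> locally_constant (fun y => fint (phi y) f a).
Proof.
move=> c y; pose U := [set A | fint A f a = fint (phi y) f a].
have [|n h] := c U _ y; first by left; exists f, a, (fint (phi y) f a).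
by exists n => z /h; rewrite /U /= => ->.
Qed.

Lemma continuous_rint (L : language) (phi : baire -> structure L) r a :
  continuous_for (@atomic_sets L) phi -> locally_constant (fun y => rint (phi y) r a).
Proof.
move=> c y; have [|n h] := c [set A | rint A r a] _ y; first by right; exists r, a.
by exists n => z /h /= E; apply/idP/idP; rewrite E.
Qed.

Lemma measurable_fint (L : language) f a :
  fibres_measurable (fun A : structure L => fint A f a).
Proof. by move=> v; apply: atomic_measurable; left; exists f, a, v. Qed.

Lemma measurable_rint (L : language) r a :
  fibres_measurable (fun A : structure L => rint A r a).
Proof.
have m : measurable [set A : structure L | rint A r a].
  by apply: atomic_measurable; right; exists r, a.
case; first exact: m.
rewrite (_ : [set x | _] = ~` [set A : structure L | rint A r a]).
  exact: measurableC.
by apply/seteqP; split => x /=; [move=> -> | move/negP/negbTE].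
Qed.

(** A point lists the values at coded arguments; a Boolean tag keeps functions and relations apart,
    and relations are read off by parity. *)
Lemma structure_parametrization (L : language) : countable_language L ->
  exists e : baire -> structure L,
    continuous_for (@atomic_sets L) e /\ forall A, exists y, e y = A.
Proof.
move=> [/countable_injP[cf icf] /countable_injP[cr icr]].
pose codef f (a : (farity f).-tuple nat) : nat := pickle (false, cf f, val a).
pose coder r (a : (rarity r).-tuple nat) : nat := pickle (true, cr r, val a).
exists (fun y => @Structure L (fun f a => y (codef f a)) (fun r a => odd (y (coder r a)))).
split.
  move=> U [[f [a [b ->]]]|[r [a ->]]] /=.
    apply: (locally_constant_bind (H := fun v _ => v = b)).
      exact: locally_constant_eval.
    by move=> v; apply: locally_constant_cst.
  apply: (locally_constant_bind (H := fun v _ => odd v : Prop)).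
    exact: locally_constant_eval.
  by move=> v; apply: locally_constant_cst.
have pickleI (x y : bool * nat * seq nat) : pickle x = pickle y -> x = y.
  by move=> E; apply: (pcan_inj pickleK).
move=> A.
exists (fun n => xget 0 [set v | (exists f a, n = codef f a /\ v = fint A f a) \/
                          (exists r a, n = coder r a /\ v = rint A r a)]).
apply: separating_atomic => U [[f [a [b ->]]]|[r [a ->]]] /=.
  congr (_ = b).
  case: xgetP => [v _ [[f' [a' [/pickleI[/icf ff aa] ->]]]|[r' [a' [/pickleI[]]]]]//|].
    have {}ff : f = f' by apply: ff; rewrite inE.
    by move: a' aa; rewrite -ff => a' /val_inj ->.
  by move=> /(_ (fint A f a)) []; left; exists f, a.
congr is_true.
case: xgetP => [v _ [[f' [a' [/pickleI[]]]]|[r' [a' [/pickleI[/icr rr aa] ->]]]]//|].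
  have {}rr : r = r' by apply: rr; rewrite inE.
  by move: a' aa; rewrite -rr => a' /val_inj ->; case: rint.
by move=> /(_ (rint A r a : nat)) []; right; exists r, a.
Qed.

(** Surjectivity of [g y] is not in itself a closed condition; carrying the inverse [h y] along
    makes bijectivity closed. *)
Lemma closed_isomorphism (L : language) (A B : baire -> structure L)
    (g h : baire -> nat -> nat) :
  continuous_for (@atomic_sets L) A -> continuous_for (@atomic_sets L) B ->
  (forall i, locally_constant (g^~ i)) -> (forall i, locally_constant (h^~ i)) ->
  closed_set [set y | [/\ isomorphism (A y) (B y) (g y),
    cancel (g y) (h y) & cancel (h y) (g y)]].
Proof.
move=> cA cB cg ch.
have lE (F : baire -> bool) : locally_constant F -> closed_set [set y | F y].
  move=> lF; apply: locally_constant_closed.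
  apply: (locally_constant_bind (H := fun (b : bool) _ => b : Prop)) => // b.
  exact: locally_constant_cst.
have lcancel (u v : baire -> nat -> nat) : (forall i, locally_constant (u^~ i)) ->
    (forall i, locally_constant (v^~ i)) -> closed_set [set y | cancel (u y) (v y)].
  move=> lu lv; apply: closed_set_forall => i; apply: locally_constant_closed.
  apply: (locally_constant_bind (H := fun w y => v y w = i)) => // w.
  apply: (locally_constant_bind (H := fun w' y => w' = i)) => // w'.
  exact: locally_constant_cst.
rewrite (_ : [set y | _] =
  ([set y | cancel (g y) (h y)] `&` [set y | cancel (h y) (g y)]) `&`
  ([set y | forall f, [set y | forall a, [set y |
      g y (fint (A y) f a) == fint (B y) f (map_tuple (g y) a)] y] y] `&`
   [set y | forall r, [set y | forall a, [set y |
      rint (A y) r a == rint (B y) r (map_tuple (g y) a)] y] y])); last first.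
  apply/seteqP; split => [y [[_ hf hr] gh hg]|y [[gh hg] [hf hr]]].
    by split; split => //= s a; apply/eqP.
  split => //; split; first by exists (h y).
    by move=> s a; apply/eqP; apply: hf.
  by move=> s a; apply/eqP; apply: hr.
have bc := locally_constant_bind_closed.
apply: closed_setI; apply: closed_setI; try exact: lcancel.
- do 2!apply: closed_set_forall => ?; apply: lE.
  apply: (bind_closed_fint _ bc cg) => f a; exact: continuous_fint.
- do 2!apply: closed_set_forall => ?; apply: lE.
  apply: (bind_closed_rint _ bc cg) => r a; exact: continuous_rint.
Qed.

(** * Borelness of the isomorphism relation *)

Lemma fibres_measurable_comp (d d' : measure_display) (X : measurableType d)
    (Y : measurableType d') (T : Type) (F : Y -> T) (p : X -> Y) :
  measurable_fun setT p -> fibres_measurable F -> fibres_measurable (F \o p).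
Proof. by move=> mp mF v; rewrite -[X in measurable X]setTI; exact: mp measurableT _ (mF v). Qed.

(** The sets [C n] are complements of Borel sets that contain the structures with a nontrivial
    stabilizer and, by Novikov separation, have empty intersection. *)
Lemma rigid_cover (L : language) (K : set (structure L)) :
  countable_language L -> measurable K ->
  (forall A, K A -> countable (Aut A)) ->
  exists C : nat -> set (structure L),
    [/\ forall n, measurable (C n), K `<=` \bigcup_n C n &
      forall n A g, K A -> C n A -> isomorphism A A g ->
        (forall i, i < n -> g i = i) -> forall i, g i = i].
Proof.
move=> cL mK cAut; have sG := @separating_atomic L.
have [e [ce se]] := structure_parametrization cL.
have bana := borel_analytic sG ce se.
(* Columns 0 and 1 of [z] hold an automorphism and its inverse; [column 2 z 0] is a point it
   moves. *)
pose Q n (A : structure L) (z : baire) :=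
  [/\ isomorphism A A (column 0 z), cancel (column 0 z) (column 1 z) &
      cancel (column 1 z) (column 0 z)] /\
  (forall i, i < n -> column 0 z i = i) /\
  column 0 z (column 2 z 0) <> column 2 z 0.
pose P n := [set A | K A /\ exists z, Q n A z].
have aP n : analytic (@atomic_sets L) (P n).
  apply: analytic_proj => [|phi cphi]; first exact: bana.
  have lc k i : locally_constant (fun y => column k (column 1 y) i).
    exact: locally_constant_eval.
  apply: closed_setI; first exact: closed_isomorphism.
  apply: closed_setI.
    apply: closed_set_forall => i; apply: locally_constant_closed.
    apply: (locally_constant_bind (H := fun v _ => i < n -> v = i)) => // v.
    exact: locally_constant_cst.
  apply: locally_constant_closed.
  apply: (locally_constant_bind
    (H := fun m y => column 0 (column 1 y) m <> m)); first exact: (lc 2 0).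
  move=> m; apply: (locally_constant_bind (H := fun v _ => v <> m)) => // v.
  exact: locally_constant_cst.
have PE n A g : K A -> isomorphism A A g -> (forall i, i < n -> g i = i) ->
    ~ P n A -> forall i, g i = i.
  move=> KA ig fg nP i; apply: contrapT => gi; apply: nP; split => //.
  have [[h gh hg] _ _] := ig.
  exists (interleave (fun k => if k is 0 then g else if k is 1 then h else fun=> i)).
  by rewrite /Q !column_interleave.
have P0 : \bigcap_n P n = set0.
  rewrite -subset0 => A PA; have [KA _] := PA 0 I.
  have [n hn] := countable_Aut_rigid (cAut A KA).
  by have [_ [z [[iz _ _] [fz]]]] := PA n I; apply; apply: hn.
have [B [mB PB B0]] := novikov_separation (@atomic_measurable L) sG aP P0.
exists (fun n => ~` B n); split.
- by move=> n; apply: measurableC.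
- by move=> A _; rewrite -setC_bigcap B0 setC0.
- by move=> n A g KA nB ig fg; apply: (PE n A) => // /PB.
Qed.

(** The inverse of [h] after [g] is an automorphism of [A] fixing the first [n] points. *)
Lemma isomorphism_extension_unique (L : language) (A B : structure L) n g h :
  (forall k, isomorphism A A k -> (forall i, i < n -> k i = i) -> forall i, k i = i) ->
  isomorphism A B g -> isomorphism A B h -> (forall i, i < n -> g i = h i) ->
  forall i, g i = h i.
Proof.
move=> rigid ig ih gh i; have [[h' hh' h'h] _ _] := ih.
have ik := isomorphism_comp ig (isomorphism_inv ih hh' h'h).
have E : h' (g i) = i by apply: (rigid _ ik) => j jn /=; rewrite gh.
by rewrite -[LHS]h'h E.
Qed.

Lemma measurable_isomorphic (L : language) (K : set (structure L)) :
  countable_language L -> measurable K ->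
  (forall A, K A -> countable (Aut A)) ->
  measurable [set AB : structure L * structure L |
    [/\ K AB.1, K AB.2 & isomorphic AB.1 AB.2]].
Proof.
move=> cL mK cAut.
have [C [mC KC rigid]] := rigid_cover cL mK cAut.
have sG := @separating_atomic L; have [e [ce se]] := structure_parametrization cL.
have bana := borel_analytic sG ce se.
pose G := product_subbasis (@atomic_sets L) (@atomic_sets L).
have mG : G `<=` measurable.
  move=> U [[V GV ->]|[V GV ->]]; rewrite -[X in measurable X]setTI.
    by apply: measurable_fst => //; apply: atomic_measurable.
  by apply: measurable_snd => //; apply: atomic_measurable.
have sGG : separating G by apply: separating_product.
have cfst (phi : baire -> structure L * structure L) :
    continuous_for G phi -> continuous_for (@atomic_sets L) (fun y => (phi y).1).
  by move=> cphi U GU; apply: (cphi (fst @^-1` U)); left; exists U.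
have csnd (phi : baire -> structure L * structure L) :
    continuous_for G phi -> continuous_for (@atomic_sets L) (fun y => (phi y).2).
  by move=> cphi U GU; apply: (cphi (snd @^-1` U)); right; exists U.
pose R n (s : seq nat) c k (AB : structure L * structure L) (z : baire) :=
  [/\ isomorphism AB.1 AB.2 (column 0 z), cancel (column 0 z) (column 1 z) &
      cancel (column 1 z) (column 0 z)] /\
  (forall i, i < n -> column 0 z i = nth 0 s i) /\ column 0 z c = k.
pose Q n s c k := [set AB | ((C n `&` K) `*` K) AB /\ exists z, R n s c k AB z].
have aQ n s c k : analytic G (Q n s c k).
  apply: analytic_proj => [|phi cphi].
    by apply: analytic_product; apply: bana => //; exact: measurableI (mC n) mK.
  have lc l i : locally_constant (fun y => column l (column 1 y) i).
    exact: locally_constant_eval.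
  apply: closed_setI; first by apply: closed_isomorphism => //; [apply: cfst | apply: csnd].
  apply: closed_setI.
    apply: closed_set_forall => i; apply: locally_constant_closed.
    apply: (locally_constant_bind (H := fun v _ => i < n -> v = nth 0 s i)) => // v.
    exact: locally_constant_cst.
  apply: locally_constant_closed.
  apply: (locally_constant_bind (H := fun v _ => v = k)) => // v.
  exact: locally_constant_cst.
have dQ n s c k l AB : Q n s c k AB -> Q n s c l AB -> k = l.
  move=> [[[Cn KA] _] [z [[iz _ _] [sz <-]]]] [_ [z' [[iz' _ _] [sz' <-]]]].
  apply: (isomorphism_extension_unique (fun k => rigid n _ k KA Cn) iz iz') => i ilt.
  by rewrite sz // sz'.
have /choice[gamma hgamma] : forall nsc : nat * seq nat * nat, exists gamma,
    fibres_measurable gamma /\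
    forall k AB, Q nsc.1.1 nsc.1.2 nsc.2 k AB -> gamma AB = k.
  by move=> [[n s] c]; exact: borel_selector mG sGG (aQ n s c) (dQ n s c).
(* Off the sets [Q] the values of [gamma] are arbitrary, so [S] tests whether they form an
   isomorphism. *)
pose S (ns : nat * seq nat) := [set AB : structure L * structure L |
  isomorphism AB.1 AB.2 (fun c => gamma (ns, c) AB)].
rewrite (_ : [set AB | _] =
  (fst @^-1` K `&` snd @^-1` K) `&` [set AB | exists ns, S ns AB]); last first.
  apply/seteqP; split => [AB [KA KB [g ig]]|AB [[KA KB] [ns iAB]]]; last first.
    by split => //; eexists; exact: iAB.
  split => //; have [n _ Cn] := KC _ KA.
  (* With the first [n] values of [g] prescribed, each [gamma] returns the value of [g]. *)
  exists (n, mkseq g n); rewrite /S /=.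
  have [[h gh hg] _ _] := ig.
  suff -> : (fun c => gamma (n, mkseq g n, c) AB) = g by [].
  apply/funext => c; have [_] := hgamma (n, mkseq g n, c); apply; split => //=.
  exists (interleave (fun k => if k is 0 then g else h)).
  by rewrite /R !column_interleave; split => //; split => // i ilt; rewrite nth_mkseq.
have m1 := @measurable_fst _ _ (structure L) (structure L).
have m2 := @measurable_snd _ _ (structure L) (structure L).
apply: measurableI.
  by apply: measurableI; rewrite -[X in measurable X]setTI;
    [exact: m1 measurableT _ mK | exact: m2 measurableT _ mK].
apply: measurable_exists => [|ns]; first exact: countableP.
apply: (measurable_isomorphism (A := fst) (B := snd)) => //.
- by move=> c; have [] := hgamma (ns, c).
- by move=> f a; exact: fibres_measurable_comp m1 (measurable_fint a).
- by move=> f a; exact: fibres_measurable_comp m2 (measurable_fint a).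
- by move=> r a; exact: fibres_measurable_comp m1 (measurable_rint a).
- by move=> r a; exact: fibres_measurable_comp m2 (measurable_rint a).
Qed.

(** * Graphs coding hereditarily countable sets *)

(** Schroeder-Bernstein: [h] is [f] on the chains that start outside the range of [g], and inverts
    [g] elsewhere, so each pair [(x, h x)] comes from [f] or [g] and satisfies [R]. *)
Lemma bijection_of_injections (X Y : Type) (R : X -> Y -> Prop) f g :
  injective f -> injective g ->
  (forall x, R x (f x)) -> (forall y, R (g y) y) ->
  exists2 h : X -> Y, bijective h & forall x, R x (h x).
Proof.
move=> finj ginj Rf Rg.
pose S := [set x | exists n x0, ~ (exists y, g y = x0) /\ x = iter n (g \o f) x0].
have SP x : S x -> S (g (f x)) by move=> [n [x0 [nx0 ->]]]; exists n.+1, x0.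
have ng x : ~ S x -> exists y, g y = x.
  by move=> nS; apply: contrapT => ny; apply: nS; exists 0, x.
have Sgf x : S x -> (exists y, g y = x) -> exists2 x', S x' & x = g (f x').
  move=> [[|n] [x0 [nx0 ->]]] ex; first by case: nx0.
  by exists (iter n (g \o f) x0) => //; exists n, x0.
have /choice[h hh] : forall x, exists y, (S x /\ y = f x) \/ (~ S x /\ g y = x).
  move=> x; have [Sx|nS] := pselect (S x); first by exists (f x); left.
  by have [y gy] := ng x nS; exists y; right.
have /choice[k hk] : forall y, exists x, h x = y.
  move=> y; have [Sg|nS] := pselect (S (g y)).
    have [|x' Sx' /ginj ->] := Sgf _ Sg; first by exists y.
    by exists x'; case: (hh x') => -[].
  by exists (g y); case: (hh (g y)) => -[] // _ /ginj.
exists h; last by move=> x; case: (hh x) => -[_]; [move-> | move=> {1}<-].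
have hinj : injective h.
  move=> x y; case: (hh x) (hh y) => -[Sx ex] [] [Sy ey] e.
  - by apply: finj; rewrite -ex -ey.
  - by case: Sy; rewrite -ey -e ex; apply: SP.
  - by case: Sx; rewrite -ex e ey; apply: SP.
  - by rewrite -ex -ey e.
by exists k; [move=> x; apply: hinj; rewrite hk | apply: hk].
Qed.

(** A bijection, unlike [pickle], since every number must be a vertex. Nonempty lists have exactly
    the positive codes, hence the predecessor. *)
Definition pair_code (p : nat * nat) : nat := (CodeSeq.code (p.1 :: CodeSeq.decode p.2)).-1.
Definition pair_decode (n : nat) : nat * nat :=
  let s := CodeSeq.decode n.+1 in (head 0 s, CodeSeq.code (behead s)).

Lemma pair_codeK : cancel pair_code pair_decode.
Proof.
move=> [i j]; rewrite /pair_code /pair_decode prednK /=.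
  by rewrite -[_ * _]/(CodeSeq.code (i :: CodeSeq.decode j)) CodeSeq.codeK /= CodeSeq.decodeK.
by rewrite muln_gt0 expn_gt0.
Qed.

Lemma pair_decodeK : cancel pair_decode pair_code.
Proof.
move=> n; rewrite /pair_code /pair_decode; have := CodeSeq.decodeK n.+1.
by case: (CodeSeq.decode n.+1) => [//|i s] E; rewrite CodeSeq.codeK E.
Qed.

Opaque pair_code pair_decode.

Definition giso (g h : rel nat) : Prop :=
  exists2 f, bijective f & forall u v, g u v = h (f u) (f v).

Lemma giso_ext (g h : rel nat) : (forall u v, g u v = h u v) -> giso g h.
Proof. by move=> E; exists id => //; exists id. Qed.

Lemma giso_refl g : giso g g.
Proof. exact: giso_ext. Qed.

Lemma giso_sym g h : giso g h -> giso h g.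
Proof.
move=> [f [f' ff' f'f] gh]; exists f'; first by exists f.
by move=> u v; rewrite gh !f'f.
Qed.

Lemma giso_trans h g k : giso g h -> giso h k -> giso g k.
Proof.
move=> [f bf gh] [f' bf' hk]; exists (f' \o f); first exact: bij_comp.
by move=> u v; rewrite gh hk.
Qed.

(** The last clause says diameter at most two: each of the two steps may stand still. *)
Definition short_graph (g : rel nat) : Prop :=
  [/\ irreflexive g, symmetric g &
      forall u v, exists w, ((u == w) || g u w) /\ ((w == v) || g w v)].

(* The complement of the disjoint union of infinitely many copies of each
   [G i].  When the [G i] are short graphs, two vertices lie in the same
   copy iff they have a common neighbour-or-equal in the complement, so the
   copies can be recovered and this graph represents, up to isomorphism, the
   set of isomorphism types { G i }. *)
Definition set_graph (G : nat -> rel nat) : rel nat := fun u v =>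
  let: (a, p) := pair_decode u in let: (b, q) := pair_decode v in
  if a == b then if p == q then false else ~~ G (pair_decode a).1 p q else true.

Lemma set_graphE G a p b q :
  set_graph G (pair_code (a, p)) (pair_code (b, q)) =
  if a == b then if p == q then false else ~~ G (pair_decode a).1 p q else true.
Proof. by rewrite /set_graph !pair_codeK. Qed.

Lemma short_set_graph G : (forall i, short_graph (G i)) -> short_graph (set_graph G).
Proof.
move=> sG; split.
- move=> u; rewrite /set_graph; case: (pair_decode u) => a p.
  by rewrite !eqxx.
- move=> u v; rewrite /set_graph; case: (pair_decode u) => a p.
  case: (pair_decode v) => b q; rewrite [b == a]eq_sym [q == p]eq_sym.
  by case: eqP => // ->; case: eqP => // _; case: (sG (pair_decode b).1) => _ ->.
- move=> u v; rewrite -(pair_decodeK u) -(pair_decodeK v).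
  case: (pair_decode u) => a p; case: (pair_decode v) => b q.
  (* A vertex in a third copy is adjacent to both. *)
  exists (pair_code ((a + b).+1, 0)); rewrite !set_graphE.
  have -> : (a == (a + b).+1) = false by rewrite ltn_eqF // ltnS leq_addr.
  by rewrite [_ == b]gtn_eqF ?ltnS ?leq_addl // !orbT.
Qed.

Lemma same_component G a p b q : (forall i, short_graph (G i)) ->
  a = b <-> exists w, ~~ set_graph G (pair_code (a, p)) w /\
                      ~~ set_graph G w (pair_code (b, q)).
Proof.
move=> sG; split=> [->|[w]].
  have [_ _ /(_ p q)[r [pr rq]]] := sG (pair_decode b).1.
  exists (pair_code (b, r)); rewrite !set_graphE !eqxx.
  by move: pr rq; case: eqP => //= _ pr; case: eqP => //= _ rq; rewrite ?negbK.
rewrite -(pair_decodeK w); case: (pair_decode w) => c r; rewrite !set_graphE.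
by case: (a =P c) => [->|_ []//]; case: (c =P b) => // _ [].
Qed.

(** By [same_component] an isomorphism respects copies, so it maps a copy of [G i] onto a copy of
    some [G' j]. *)
Lemma set_graph_iso_sub G G' :
  (forall i, short_graph (G i)) -> (forall i, short_graph (G' i)) ->
  giso (set_graph G) (set_graph G') -> forall i, exists j, giso (G i) (G' j).
Proof.
move=> sG sG' [f [f' ff' f'f] fE] i.
have comp a p b q : a = b <->
    (pair_decode (f (pair_code (a, p)))).1 = (pair_decode (f (pair_code (b, q)))).1.
  rewrite (same_component a p b q sG).
  rewrite (same_component _ (pair_decode (f (pair_code (a, p)))).2 _
    (pair_decode (f (pair_code (b, q)))).2 sG') -!surjective_pairing !pair_decodeK.
  split=> [[w [w1 w2]]|[w [w1 w2]]]; first by exists (f w); rewrite -!fE.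
  by exists (f' w); rewrite !fE f'f.
pose a := pair_code (i, 0); pose b := (pair_decode (f (pair_code (a, 0)))).1.
pose k p := (pair_decode (f (pair_code (a, p)))).2.
have kE p : f (pair_code (a, p)) = pair_code (b, k p).
  rewrite -[LHS]pair_decodeK [pair_decode _]surjective_pairing.
  by rewrite ((comp a p a 0).1 erefl).
exists (pair_decode b).1; exists k.
  exists (fun q => (pair_decode (f' (pair_code (b, q)))).2).
    by move=> p; rewrite -kE ff' pair_codeK.
  move=> q.
  suff E : f' (pair_code (b, q)) = pair_code (a, (pair_decode (f' (pair_code (b, q)))).2).
    by rewrite /k -E f'f pair_codeK.
  rewrite -[LHS]pair_decodeK [pair_decode _]surjective_pairing; congr (pair_code (_, _)).
  apply/(comp _ (pair_decode (f' (pair_code (b, q)))).2 _ 0).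
  by rewrite -surjective_pairing pair_decodeK f'f pair_codeK.
have kinj : injective k.
  move=> p q e; have /(can_inj ff')/(can_inj pair_codeK) :
    f (pair_code (a, p)) = f (pair_code (a, q)) by rewrite !kE e.
  by case.
move=> p q; have := fE (pair_code (a, p)) (pair_code (a, q)).
rewrite !kE !set_graphE !eqxx (inj_eq kinj) pair_codeK /=.
case: eqP => [-> _|_ /negb_inj //].
by have [-> _ _] := sG i; have [-> _ _] := sG' (pair_decode b).1.
Qed.

(** As each graph has infinitely many copies, the copies inject into each other both ways respecting
    isomorphism type; Schroeder-Bernstein then matches them. *)
Lemma set_graph_iso G G' :
  (forall i, exists j, giso (G i) (G' j)) -> (forall j, exists i, giso (G i) (G' j)) ->
  giso (set_graph G) (set_graph G').
Proof.
move=> /choice[s hs] /choice[t ht].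
pose next (r : nat -> nat) a := pair_code (r (pair_decode a).1, a).
have nextinj r : injective (next r).
  by move=> a b /(can_inj pair_codeK)[_ ->].
have [||sigma [tau st ts] hsigma] := bijection_of_injections
    (R := fun a b => giso (G (pair_decode a).1) (G' (pair_decode b).1))
    (nextinj s) (nextinj t).
- by move=> a; rewrite /next pair_codeK; apply: hs.
- by move=> a; rewrite /next pair_codeK; apply: ht.
have /choice[k hk] : forall a, exists kk : (nat -> nat) * (nat -> nat),
    [/\ cancel kk.1 kk.2, cancel kk.2 kk.1 & forall p q,
     G (pair_decode a).1 p q = G' (pair_decode (sigma a)).1 (kk.1 p) (kk.1 q)].
  by move=> a; have [h [h' hh' h'h] E] := hsigma a; exists (h, h').
exists (fun u => pair_code (sigma (pair_decode u).1,
                            (k (pair_decode u).1).1 (pair_decode u).2)).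
  exists (fun u => pair_code (tau (pair_decode u).1,
                              (k (tau (pair_decode u).1)).2 (pair_decode u).2)).
    move=> u; rewrite !pair_codeK /= st; have [-> _ _] := hk (pair_decode u).1.
    by rewrite -surjective_pairing pair_decodeK.
  move=> u; rewrite !pair_codeK /= ts; have [_ -> _] := hk (tau (pair_decode u).1).
  by rewrite -surjective_pairing pair_decodeK.
move=> u v; rewrite set_graphE /set_graph.
case: (pair_decode u) => a p; case: (pair_decode v) => b q /=.
rewrite (can_eq st); case: eqP => // <-.
by have [c _ ->] := hk a; rewrite (can_eq c).
Qed.

Lemma set_graph_congr G G' :
  (forall i, giso (G i) (G' i)) -> giso (set_graph G) (set_graph G').
Proof. by move=> E; apply: set_graph_iso => i; exists i. Qed.

Definition upair_graph (g h : rel nat) : rel nat :=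
  set_graph (fun i => if i is 0 then g else h).

(** Kuratowski's ordered pair. *)
Definition pair_graph (g h : rel nat) : rel nat :=
  upair_graph (upair_graph g g) (upair_graph g h).

Lemma short_upair g h : short_graph g -> short_graph h -> short_graph (upair_graph g h).
Proof. by move=> sg sh; apply: short_set_graph => -[]. Qed.

Lemma short_pair g h : short_graph g -> short_graph h -> short_graph (pair_graph g h).
Proof. by move=> sg sh; do !apply: short_upair. Qed.

Lemma upair_congr g h g' h' :
  giso g g' -> giso h h' -> giso (upair_graph g h) (upair_graph g' h').
Proof. by move=> eg eh; apply: set_graph_congr => -[]. Qed.

Lemma pair_congr g h g' h' :
  giso g g' -> giso h h' -> giso (pair_graph g h) (pair_graph g' h').
Proof. by move=> eg eh; do !apply: upair_congr. Qed.

Lemma upair_iso_cases g h g' h' :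
  short_graph g -> short_graph h -> short_graph g' -> short_graph h' ->
  giso (upair_graph g h) (upair_graph g' h') ->
  (giso g g' /\ giso h h') \/ (giso g h' /\ giso h g').
Proof.
move=> sg sh sg' sh' e.
have s1 i : short_graph (if i is 0 then g else h) by case: i.
have s2 i : short_graph (if i is 0 then g' else h') by case: i.
have e1 := set_graph_iso_sub s1 s2 e.
have e2 := set_graph_iso_sub s2 s1 (giso_sym e).
have c0 : giso g g' \/ giso g h' by case: (e1 0) => -[] *; [left | right].
have c1 : giso h g' \/ giso h h' by case: (e1 1) => -[] *; [left | right].
have d0 : giso g' g \/ giso g' h by case: (e2 0) => -[] *; [left | right].
have d1 : giso h' g \/ giso h' h by case: (e2 1) => -[] *; [left | right].
case: c0 c1 => [gg|gh] [hg|hh]; [left|by left|by right|right]; split => //.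
  by case: d1 => /giso_sym // gh; apply: giso_trans hg (giso_trans (giso_sym gg) gh).
by case: d0 => /giso_sym // gg; apply: giso_trans hh (giso_trans (giso_sym gh) gg).
Qed.

Lemma pair_iso_inj g h g' h' :
  short_graph g -> short_graph h -> short_graph g' -> short_graph h' ->
  giso (pair_graph g h) (pair_graph g' h') -> giso g g' /\ giso h h'.
Proof.
move=> sg sh sg' sh'.
move=> /(upair_iso_cases (short_upair sg sg) (short_upair sg sh)
  (short_upair sg' sg') (short_upair sg' sh'))[[e1 e2]|[e1 e2]].
  have gg : giso g g' by case: (upair_iso_cases sg sg sg' sg' e1) => -[].
  split=> //; case: (upair_iso_cases sg sh sg' sh' e2) => -[] // gh hg.
  exact: giso_trans hg (giso_trans (giso_sym gg) gh).
have [gg gh] : giso g g' /\ giso g h'.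
  by case: (upair_iso_cases sg sg sg' sh' e1) => -[].
have hg : giso h g' by case: (upair_iso_cases sg sh sg' sg' e2) => -[].
by split=> //; apply: giso_trans hg (giso_trans (giso_sym gg) gh).
Qed.

(** * Isomorphism of graphs is not Borel *)

(* [u + v != 1] excludes exactly the edge {0, 1}. *)
Definition base_graph (b : bool) : rel nat :=
  fun u v => (u != v) && (b || (u + v != 1)).

(** Zermelo numerals: iterated singletons over the complete graph, which serves as an atom. *)
Definition label_graph (n : nat) : rel nat :=
  iter n (fun g => upair_graph g g) (base_graph true).

Lemma short_base b : short_graph (base_graph b).
Proof.
split=> [u|u v|u v]; first by rewrite /base_graph eqxx.
  by rewrite /base_graph eq_sym addnC.
have h1 : u < (u + v).+2 by rewrite ltnS leqW ?leq_addr.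
have h2 : v < (u + v).+2 by rewrite ltnS leqW ?leq_addl.
by exists (u + v).+2; rewrite /base_graph (ltn_eqF h1) (gtn_eqF h2) !addnS !addSn !orbT.
Qed.

Lemma short_label n : short_graph (label_graph n).
Proof. by elim: n => [|n IH]; [apply: short_base | apply: short_upair]. Qed.

Lemma base_true_false : ~ giso (base_graph true) (base_graph false).
Proof.
move=> /giso_sym[f [f' ff' _]] /(_ 0 1).
by rewrite /base_graph (can_eq ff').
Qed.

(** A short graph has an edge, and an edge of [G i] becomes a non-edge between distinct vertices of
    its copy. *)
Lemma complete_not_set_graph G : (forall i, short_graph (G i)) ->
  ~ giso (base_graph true) (set_graph G).
Proof.
move=> sG /giso_sym[f [f' ff' _] fE].
pose i := (pair_decode 0).1.
have [p [q [pq Gpq]]] : exists p q, p != q /\ G i p q.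
  have [irr _ /(_ 0 1)[w [w0 w1]]] := sG i.
  have h p q : G i p q -> exists p q, p != q /\ G i p q.
    move=> g; exists p, q; split => //; apply/eqP => e.
    by move: g; rewrite e irr.
  by case/orP: w0 => [/eqP e|/h //]; move: w1; rewrite -e => /orP[//|/h].
have := fE (pair_code (0, p)) (pair_code (0, q)).
rewrite set_graphE eqxx (negbTE pq) Gpq /base_graph (can_eq ff') (can_eq pair_codeK).
by rewrite xpair_eqE eqxx pq.
Qed.

Lemma label_inj m n : giso (label_graph m) (label_graph n) -> m = n.
Proof.
have sl k i : short_graph (if i is 0 then label_graph k else label_graph k).
  by case: i => [|i]; apply: short_label.
elim: m n => [|m IH] [|n] //=.
- by move=> /complete_not_set_graph []; apply: sl.
- by move=> /giso_sym /complete_not_set_graph []; apply: sl.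
- move=> e; congr S; apply: IH.
  have s := @short_label.
  by case: (upair_iso_cases (s m) (s m) (s n) (s n) e) => -[].
Qed.

(** A sequence as a set of ordered pairs; the labels make its entries recoverable. *)
Definition seq_graph (g : nat -> rel nat) : rel nat :=
  set_graph (fun n => pair_graph (label_graph n) (g n)).

Lemma short_seq g : (forall n, short_graph (g n)) -> short_graph (seq_graph g).
Proof. by move=> sg; apply: short_set_graph => n; apply: short_pair => //; apply: short_label. Qed.

Lemma seq_congr g h : (forall n, giso (g n) (h n)) -> giso (seq_graph g) (seq_graph h).
Proof. by move=> e; apply: set_graph_congr => n; apply: pair_congr => //; apply: giso_refl. Qed.

Lemma seq_iso_inj g h :
  (forall n, short_graph (g n)) -> (forall n, short_graph (h n)) ->
  giso (seq_graph g) (seq_graph h) -> forall n, giso (g n) (h n).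
Proof.
move=> sg sh e n; have sl := short_label.
have := set_graph_iso_sub _ _ e n.
case=> [i|i|m]; try exact: short_pair.
by case/pair_iso_inj => // /label_inj ->.
Qed.

(** * Families of graphs deciding Borel sets *)

Definition literal : Type := bool * option (nat * nat).

Definition eval_literal (x : structure graph_language) (l : literal) : bool :=
  l.1 (+) (if l.2 is Some (i, j) then edge x i j else false).

(** [F] does not depend on [x], so a simple family is countable data, which a single structure can
    code. *)
Definition simple (S : structure graph_language -> rel nat) : Prop :=
  exists F : nat -> nat -> literal, forall x u v, S x u v = eval_literal x (F u v).

Lemma simple_cst g : simple (fun=> g).
Proof. by exists (fun u v => (g u v, None)) => x u v; rewrite /eval_literal addbF. Qed.

(** Each adjacency of a set graph is constant or negates one adjacency of one [S i]. *)
Lemma simple_set_graph (S : nat -> structure graph_language -> rel nat) :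
  (forall i, simple (S i)) -> simple (fun x => set_graph (S^~ x)).
Proof.
move=> /choice[F hF].
exists (fun u v => let: (a, p) := pair_decode u in let: (b, q) := pair_decode v in
  if a == b then if p == q then (false, None)
    else (~~ (F (pair_decode a).1 p q).1, (F (pair_decode a).1 p q).2)
  else (true, None)) => x u v.
rewrite /set_graph; case: (pair_decode u) => a p; case: (pair_decode v) => b q.
by case: eqP => // _; case: eqP => // _; rewrite hF /eval_literal /= -addNb.
Qed.

Lemma simple_upair S S' :
  simple S -> simple S' -> simple (fun x => upair_graph (S x) (S' x)).
Proof.
move=> s s'.
have [F hF] : simple (fun x => set_graph ((fun i => if i is 0 then S else S')^~ x)).
  by apply: simple_set_graph => -[].
exists F => x u v; rewrite -hF /upair_graph; congr (set_graph _ _ _).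
by apply/funext => -[].
Qed.

Lemma simple_pair S S' :
  simple S -> simple S' -> simple (fun x => pair_graph (S x) (S' x)).
Proof. by move=> s s'; do !apply: simple_upair. Qed.

Lemma simple_seq (S : nat -> structure graph_language -> rel nat) :
  (forall i, simple (S i)) -> simple (fun x => seq_graph (S^~ x)).
Proof.
move=> s.
apply: (@simple_set_graph (fun n x => pair_graph (label_graph n) (S n x))) => n.
by apply: simple_pair => //; apply: simple_cst.
Qed.

(* Membership in [B] is reduced to isomorphism with [T true]; the family
   [S true] does the same for the complement of [B], with the same [T]. *)
Definition codes (T : bool -> rel nat) (S : bool -> structure graph_language -> rel nat)
    (B : set (structure graph_language)) : Prop :=
  [/\ forall b, short_graph (T b), ~ giso (T true) (T false),
      forall s, simple (S s) & forall s x, giso (S s x) (T (s (+) `[< B x >]))].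

Definition codeable (B : set (structure graph_language)) : Prop :=
  exists T S, codes T S B.

Lemma codes_inj T S B b c : codes T S B -> giso (T b) (T c) -> b = c.
Proof. by move=> [_ ne _ _]; case: b; case: c => // /giso_sym. Qed.

Lemma codeable_atomic i j : codeable [set x | edge x i j].
Proof.
exists base_graph, (fun s x => base_graph (s (+) edge x i j)); split.
- exact: short_base.
- exact: base_true_false.
- move=> s; exists (fun u v => if u == v then (false, None) else
    if u + v == 1 then (s, Some (i, j)) else (true, None)) => x u v.
  rewrite /base_graph /eval_literal; case: eqP => // _; case: eqP => // _ /=.
    by rewrite orbF.
  by rewrite orbT.
- by move=> s x; rewrite asboolb; apply: giso_refl.
Qed.

Lemma codeable0 : codeable set0.
Proof.
exists base_graph, (fun s _ => base_graph s); split.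
- exact: short_base.
- exact: base_true_false.
- by move=> s; apply: simple_cst.
- by move=> s x; rewrite asboolF // addbF; apply: giso_refl.
Qed.

Lemma codeableC B : codeable B -> codeable (~` B).
Proof.
move=> [T [S [sT ne sS e]]]; exists T, (fun s => S (~~ s)); split => // s x.
by rewrite (_ : _ (+) _ = ~~ s (+) `[< B x >]) // /setC /= asbool_neg addNb addbN.
Qed.

(* With a and b the truth values of [B x] and [C x], the set
   { (a, b + s), (~ a, s), (0, ~ b + s), (0, ~ s) }, where [+] is exclusive or,
   equals { (1, c), (0, 0), (0, 1) } for c = s + (a /\ b). *)
Lemma codeableI B C : codeable B -> codeable C -> codeable (B `&` C).
Proof.
move=> [TB [SB cB]] [TC [SC cC]].
have [sTB neB sSB eB] := cB; have [sTC neC sSC eC] := cC.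
pose Q (p : bool * bool) := pair_graph (TB p.1) (TC p.2).
have sQ p : short_graph (Q p) by apply: short_pair.
have Qinj p q : giso (Q p) (Q q) -> p = q.
  case: p q => [a b] [a' b'] /pair_iso_inj[]//.
  by move=> /(codes_inj cB) /= -> /(codes_inj cC) /= ->.
pose R s i (x : structure graph_language) : rel nat := match i with
  | 0 => pair_graph (SB false x) (SC s x)
  | 1 => pair_graph (SB true x) (TC s)
  | 2 => pair_graph (TB false) (SC (~~ s) x)
  | _ => pair_graph (TB false) (TC (~~ s)) end.
pose tgt c i := match i with 0 => (true, c) | 1 => (false, false) | _ => (false, true) end.
pose src (a b s : bool) i := match i with 0 => (a, s (+) b) | 1 => (~~ a, s)
  | 2 => (false, ~~ s (+) b) | _ => (false, ~~ s) end.
have src_tgt a b s i : exists j, src a b s i = tgt (s (+) (a && b)) j.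
  by case: i a b s => [|[|[|i]]] [] [] [] /=; by [exists 0 | exists 1 | exists 2].
have tgt_src a b s j : exists i, src a b s i = tgt (s (+) (a && b)) j.
  by case: j a b s => [|[|j]] [] [] [] /=;
    by [exists 0 | exists 1 | exists 2 | exists 3].
pose T c i := Q (tgt c i).
exists (fun c => set_graph (T c)), (fun s x => set_graph ((R s)^~ x)); split.
- by move=> c; apply: short_set_graph => i; apply: sQ.
- move=> /set_graph_iso_sub h; have [i|i|i] := h _ _ 0; try exact: sQ.
  by move=> /Qinj; case: i => [|[|i]].
- move=> s.
  by apply: simple_set_graph => -[|[|[|i]]]; apply: simple_pair => //; apply: simple_cst.
- move=> s x.
  pose q := src `[< B x >] `[< C x >] s.
  have hq i : giso (R s i x) (Q (q i)).
    by case: i => [|[|[|i]]]; apply: pair_congr;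
      solve [exact: eB | exact: eC | exact: giso_refl].
  apply: (@giso_trans (set_graph (fun i => Q (q i)))); first exact: set_graph_congr.
  rewrite asbool_and; apply: set_graph_iso => [i|j].
    by have [j qi] := src_tgt `[< B x >] `[< C x >] s i; exists j; rewrite /T -qi;
      apply: giso_refl.
  by have [i qi] := tgt_src `[< B x >] `[< C x >] s j; exists i; rewrite /T -qi;
    apply: giso_refl.
Qed.

Definition override (m : seq bool) (b : nat -> bool) : nat -> bool :=
  fun n => nth (b n) m n.

Lemma override_eventually (b c : nat -> bool) N m :
  (forall n, N <= n -> b n = c n) -> exists m', forall n, override m b n = override m' c n.
Proof.
move=> bc; pose M := maxn N (size m).
exists (mkseq (override m b) M) => n; rewrite {2}/override.
have [nM|Mn] := ltnP n M; first by rewrite nth_mkseq.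
rewrite nth_default ?size_mkseq // /override nth_default; last first.
  exact: leq_trans (leq_maxr _ _) Mn.
by apply: bc; apply: leq_trans (leq_maxl _ _) Mn.
Qed.

Definition seq_of_nat (k : nat) : seq bool := odflt [::] (unpickle k).

(* The truth values of [B n x] form a decreasing sequence, so up to finite
   modifications they are constant, with value the truth value of
   [(\bigcap_n B n) x]. *)
Lemma codeable_decreasing_bigcap (B : nat -> set (structure graph_language)) :
  (forall n, codeable (B n)) -> (forall n, B n.+1 `<=` B n) ->
  codeable (\bigcap_n B n).
Proof.
move=> cB dB; have [T hT] := choice cB; have [S hS] := choice hT.
have dB' m n : m <= n -> B n `<=` B m.
  by move/subnK <-; elim: (n - m) => // k IH x /dB /IH.
have sT n b : short_graph (T n b) by case: (hS n).
pose Q (b : nat -> bool) := seq_graph (fun n => T n (b n)).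
have sQ b : short_graph (Q b) by apply: short_seq.
pose R s k x := seq_graph (fun n =>
  if n < size (seq_of_nat k) then T n (nth false (seq_of_nat k) n) else S n s x).
exists (fun c => set_graph (fun k => Q (override (seq_of_nat k) (fun=> c)))),
  (fun s x => set_graph (fun k => R s k x)); split.
- by move=> c; apply: short_set_graph.
- move=> /set_graph_iso_sub h.
  (* The unmodified sequence [true] would be a finite modification of the sequence [false]; an entry
     beyond the override refutes this. *)
  have [k|k|k hk] := h _ _ (pickle ([::] : seq bool)); try exact: sQ.
  have := seq_iso_inj (fun n => sT n _) (fun n => sT n _) hk (size (seq_of_nat k)).
  move=> /(codes_inj (hS _)).
  by rewrite /override /seq_of_nat pickleK /= nth_nil nth_default.
- move=> s; apply: (simple_set_graph (S := R s)) => k.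
  apply: (simple_seq (S := fun n x => if n < size (seq_of_nat k)
     then T n (nth false (seq_of_nat k) n) else S n s x)) => n.
  case: (n < _); [exact: simple_cst | by case: (hS n)].
- move=> s x; pose b n := s (+) `[< B n x >]; pose c := s (+) `[< (\bigcap_n B n) x >].
  have [N hN] : exists N, forall n, N <= n -> b n = c.
    have [Bx|nBx] := pselect ((\bigcap_n B n) x).
      by exists 0 => n _; rewrite /b /c !asboolT //; apply: Bx.
    have [N nBN] : exists N, ~ B N x.
      by apply: contrapT => h; apply: nBx => n _; apply: contrapT => nB; apply: h; exists n.
    exists N => n Nn; rewrite /b /c !asboolF // => Bn.
    by apply: nBN; apply: dB' Bn.
  apply: (@giso_trans (set_graph (fun k => Q (override (seq_of_nat k) b)))).
    apply: set_graph_congr => k; apply: seq_congr => n; rewrite /override.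
    case: ltnP => [nk|kn]; first by rewrite (set_nth_default false) //; apply: giso_refl.
    by rewrite nth_default //; case: (hS n).
  have Qext d d' : (forall n, d n = d' n) -> giso (Q d) (Q d').
    by move=> dd; apply: seq_congr => n; rewrite dd; apply: giso_refl.
  apply: set_graph_iso => k.
    have [m hm] := override_eventually (seq_of_nat k) hN.
    by exists (pickle m); rewrite {2}/seq_of_nat pickleK; apply: Qext.
  have [m hm] := override_eventually (seq_of_nat k) (fun n Nn => esym (hN n Nn)).
  exists (pickle m); rewrite {1}/seq_of_nat pickleK; apply: Qext => n.
  by rewrite hm.
Qed.

(** Codeable sets form a sigma-algebra: complements turn unions into intersections, and partial
    intersections [D] make these decreasing. *)
Lemma codeable_measurable (B : set (structure graph_language)) :
  measurable B -> codeable B.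
Proof.
suff : <<s @atomic_sets graph_language >> `<=` codeable by apply.
apply: smallest_sub; last first.
  move=> U [[[]]|[[] [a ->]]].
  have E (x : structure graph_language) : rint x (tt : rsym graph_language) a =
      edge x (nth 0 a 0) (nth 0 a 1).
    rewrite /edge; congr rint; apply: val_inj => /=.
    by case: a => -[|u [|v []]].
  rewrite (_ : [set A | _] = [set x | edge x (nth 0 a 0) (nth 0 a 1)]).
    exact: codeable_atomic.
  by apply/seteqP; split => x /=; rewrite E.
split; first exact: codeable0.
  by move=> A cA; rewrite setTD; apply: codeableC.
move=> F cF; rewrite -[\bigcup_i F i]setCK; apply: codeableC.
rewrite setC_bigcup.
pose D := fix D n := if n is n'.+1 then D n' `&` ~` F n'.+1 else ~` F 0.
have -> : \bigcap_i ~` F i = \bigcap_i D i.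
  apply/seteqP; split => x hx n _; last by case: n (hx n I) => // n [].
  by elim: n => [|n IH]; [exact: hx | split => //; exact: hx].
apply: codeable_decreasing_bigcap; last by move=> n x [].
elim=> [|n IH] /=; first exact: codeableC.
by apply: codeableI => //; apply: codeableC.
Qed.

(** * The diagonal argument *)

Definition graph_structure (g : rel nat) : structure graph_language :=
  @Structure graph_language (fun f _ => match f with end)
    (fun _ a => g (nth 0 a 0) (nth 0 a 1)).

Lemma isomorphic_graph_structure g h :
  isomorphic (graph_structure g) (graph_structure h) <-> giso g h.
Proof.
split=> [[f [bf _ fE]]|[f bf fE]]; exists f => //.
  by move=> u v; apply: (fE tt [tuple u; v]).
split => // -[] a /=.
by rewrite fE !(nth_map 0) ?size_tuple.
Qed.

Lemma measurable_graph_structure (d : measure_display) (X : measurableType d)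
    (g : X -> rel nat) :
  (forall u v, measurable [set x | g x u v]) ->
  measurable_fun setT (fun x => graph_structure (g x)).
Proof.
move=> mg; apply: (@measurability _ _ _ _ _ _ (@atomic_sets graph_language)) => //.
move=> _ [_ [[[]]|[r [a ->]]] <-]; rewrite setTI.
exact: mg.
Qed.

(* A point [c] codes a simple family [Phi c] and a graph [Psi c]; every Borel
   set is { x | Phi c x ~ Psi c } for some [c], whereas the Borel set [D] is
   the complement of the diagonal of these sets. *)
Lemma graph_isomorphism_not_measurable :
  ~ measurable [set AB : structure graph_language * structure graph_language |
      [/\ graphs AB.1, graphs AB.2 & isomorphic AB.1 AB.2]].
Proof.
set E := [set AB | _]; move=> mE.
have [cv cv_inj] : exists cv : nat * nat -> nat, injective cv.
  by exists pickle; apply: pcan_inj pickleK.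
have [cl cl_inj] : exists cl : option literal -> nat, injective cl.
  by exists pickle; apply: pcan_inj pickleK.
(* The bits of [c] at [cl (Some l)] list literals for an edge of [Phi c]; the bit at [cl None] is
   that edge of [Psi c]. *)
pose Phi (c x : structure graph_language) : rel nat := fun u v =>
  `[< exists l : literal,
      edge c (cv (u, v)) (cl (Some l)) /\ eval_literal x l >].
pose Psi (c : structure graph_language) : rel nat := fun u v =>
  edge c (cv (u, v)) (cl None).
pose F x := (graph_structure (Phi x x), graph_structure (Psi x)).
have medge i j : measurable [set x : structure graph_language | edge x i j].
  by apply: sub_sigma_algebra; right; exists tt, [tuple i; j].
have mF : measurable_fun setT F.
  apply: measurable_fun_pair; apply: measurable_graph_structure => u v; last exact: medge.
  rewrite (_ : [set x | _] = [set x | exists l : literal,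
      ([set x | edge x (cv (u, v)) (cl (Some l))] `&` [set x | eval_literal x l]) x]).
    apply: measurable_exists => [|[s o]]; first exact: countableP.
    apply: measurableI; first exact: medge.
    case: o => [[i j]|]; rewrite /eval_literal /=; last first.
      case: s; first by rewrite (_ : [set x | _] = setT) //; apply/seteqP; split.
      by rewrite (_ : [set x | _] = set0) //; apply/seteqP; split.
    case: s => /=; last exact: medge.
    rewrite (_ : [set x | _] = ~` [set x | edge x i j]); first exact: measurableC.
    by apply/seteqP; split => x /= /negP.
  by apply/seteqP; split => x /= /asboolP.
pose D := ~` (F @^-1` E).
have mD : measurable D.
  apply: measurableC; rewrite -[X in measurable X]setTI.
  exact: mF measurableT _ mE.
have [T [S [sT ne sS eS]]] := codeable_measurable mD.
have [G hG] := sS false.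
(* [c] codes the family and the target that decide [D]. It need not be symmetric, as [D] is a set of
   arbitrary structures. *)
pose c := graph_structure (fun p q => `[< exists u v, p = cv (u, v) /\
  (q = cl (Some (G u v)) \/ (q = cl None /\ T true u v)) >]).
have PhiE x u v : Phi c x u v = S false x u v.
  rewrite hG; apply/asboolP/idP => [[l [/asboolP[u' [v' [/cv_inj[<- <-]]]]]]|h].
    by case=> [/cl_inj[->]|[/cl_inj]].
  exists (G u v); split => //; apply/asboolP; exists u, v; split => //; by left.
have PsiE u v : Psi c u v = T true u v.
  apply/asboolP/idP => [[u' [v' [/cv_inj[<- <-]]]]|h].
    by case=> [/cl_inj|[_]].
  by exists u, v; split => //; right.
have graphsT b : graphs (graph_structure (T b)).
  by have [irr sym _] := sT b; split => [u|u v]; [exact: irr | exact: sym].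
have iso_graphs g h : giso g h -> graphs (graph_structure h) -> graphs (graph_structure g).
  move=> [f _ fE] [irr sym]; split => [u|u v]; rewrite /edge /= !fE; [exact: irr | exact: sym].
have ePhi : giso (Phi c c) (T `[< D c >]).
  apply: giso_trans (eS false c); exact: giso_ext.
have ePsi : giso (Psi c) (T true) by apply: giso_ext.
(* By the coding, [D c] holds exactly when [Phi c c] and [Psi c] are isomorphic, which is what [D]
   denies. *)
have [Dc|nDc] := pselect (D c).
  apply: (Dc); split => /=; try by apply: iso_graphs; [eassumption | exact: graphsT].
  apply/isomorphic_graph_structure; apply: giso_trans ePhi _.
  by rewrite asboolT //; apply: giso_sym.
rewrite asboolF // in ePhi; apply: nDc => -[_ _ /isomorphic_graph_structure e].
apply: ne; apply: giso_trans (giso_sym ePsi) _; exact: giso_trans (giso_sym e) ePhi.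
Qed.

Theorem proposition1p2 (L : language) (hL : countable_language L)
    (K : set (structure L)) (hK : measurable K)
    (hAut : forall A : structure L, K A -> countable (Aut A)) :
  measurable [set AB : structure L * structure L |
               [/\ K AB.1, K AB.2 & isomorphic AB.1 AB.2]] /\
  ~ borel_complete K.
Proof.
have mI := measurable_isomorphic hL hK hAut; split => // -[f [mf fK fiso]].
apply: graph_isomorphism_not_measurable.
pose G2 := [set AB : structure graph_language * structure graph_language |
  graphs AB.1 /\ graphs AB.2].
have mG2 : measurable G2.
  by apply: measurableI; rewrite -[X in measurable X]setTI;
    [exact: measurable_fst measurableT _ measurable_graphs
    |exact: measurable_snd measurableT _ measurable_graphs].
(* [f] is measurable only on [graphs]; a constant value off this Borel set gives a total Borel
   map. *)
pose f' x := if `[< graphs x >] then f x else f point.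
have mf' : measurable_fun setT f'.
  move=> _ B mB; rewrite setTI.
  rewrite (_ : _ @^-1` B = (graphs `&` f @^-1` B) `|`
      (~` graphs `&` [set _ | B (f point)])).
    apply: measurableU; first exact: mf measurable_graphs _ mB.
    apply: measurableI; first exact: measurableC measurable_graphs.
    have [Bf|nBf] := pselect (B (f point)).
      by rewrite (_ : [set _ | _] = setT) //; apply/seteqP; split.
    by rewrite (_ : [set _ | _] = set0) //; apply/seteqP; split.
  apply/seteqP; split => x /=; rewrite /f'.
    by case: asboolP => gx Bx; [left | right].
  by case: asboolP => gx [] [].
have mff : measurable_fun setT (fun AB => (f' AB.1, f' AB.2)).
  by apply: measurable_fun_pair; apply: measurableT_comp mf' _;
    [exact: measurable_fst | exact: measurable_snd].
(* As [f] is a reduction, graph isomorphism is, within [G2], the preimage of isomorphism on [K]. *)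
rewrite (_ : [set AB | _] = G2 `&` (fun AB => (f' AB.1, f' AB.2)) @^-1`
    [set AB | [/\ K AB.1, K AB.2 & isomorphic AB.1 AB.2]]).
  by apply: measurableI => //; rewrite -[X in measurable X]setTI; exact: mff measurableT _ mI.
have f'E x : graphs x -> f' x = f x by move=> gx; rewrite /f' asboolT.
apply/seteqP; split => [[A B] /= [gA gB iAB]|[A B] /= [[/= gA gB]]]; rewrite /= !f'E //.
  split => //; split; [by apply: fK; exists A | by apply: fK; exists B |].
  exact/fiso.
by move=> [_ _ iAB]; split => //; apply/fiso.
Qed.
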